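(* Let $p$ be a prime ($p=2$ allowed) and let $G$ be a finite $p$-group with $d(G)=3$, $\Phi(G)\le Z(G)$ and $G'\cong C_p^3$. Suppose the type of $G/G'$ is $(p^{m_1},p^{m_2},p^{m_3})$ with $m_1=m_2>m_3$. Then one can choose suitable (characteristic) generators of $G$ such that the characteristic matrix of $G$ is one of the following matrices, and different matrices give non-isomorphic groups. Here $\nu\in\{1,\eta\}$, $t\in F_p$ with $t\ne0$, and $r\in\{1,2,\dots,p-2\}$. (1) For odd $p$: (G1) $-e_{12}+e_{21}+e_{33}$; (G2) $\nu e_{11}-e_{12}+e_{21}+e_{33}$; (G3) $e_{11}+\nu e_{22}+e_{33}$; (G4) $e_{11}-e_{12}+e_{21}+re_{22}+e_{33}$; (H1) $-e_{12}+e_{21}$; (H2) $e_{11}-e_{12}+e_{21}$; (H3) $e_{11}+\nu e_{22}$; (H4) $e_{11}-e_{12}+e_{21}+re_{22}$. (2) For $p=2$: (G5) $e_{12}+e_{21}+e_{33}$; (G6) $e_{11}+e_{22}+e_{33}$; (G7) $e_{11}+e_{12}+e_{22}+e_{33}$; (H5) $e_{12}+e_{21}$; (H6) $e_{11}+e_{22}$; (H7) $e_{11}+e_{12}+e_{22}$. (3) For both odd $p$ and $p=2$: (G8) $e_{11}+e_{23}+te_{32}$; (G9) $e_{12}+e_{23}+e_{31}$; (H8) $e_{21}+e_{33}$; (H9) $\nu e_{22}+e_{33}$; (H10) $e_{21}+e_{32}$; (H11) $e_{22}+e_{31}$; (H12) $e_{11}+e_{23}$; (H13) $e_{12}+e_{23}$;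 (H14) $e_{23}+e_{31}$; (H15) $e_{23}+te_{32}$; (I1) $e_{33}$; (I2) $e_{21}$; (I3) $e_{22}$; (I4) $e_{31}$; (I5) $0$; (I6) $e_{23}$.
   Context: $d(G)$ is the minimal number of generators of $G$, $\Phi(G)$ the Frattini subgroup, $G'$ the derived subgroup, $C_p^3$ the elementary abelian group of order $p^3$. $F_p$ is the field with $p$ elements. For odd $p$, $\eta$ is a fixed square non-residue modulo $p$; for $p=2$ parameters ranging over $\{1,\eta\}$ are equal to $1$. $e_{ij}$ denotes the $3\times3$ matrix over $F_p$ with $1$ in position $(i,j)$ and $0$ elsewhere. Characteristic matrix: let $G$ be a finite $p$-group with $d(G)=3$, $\Phi(G)\le Z(G)$, $G'\cong C_p^3$, and $G/G'$ of type $(p^{m_1},p^{m_2},p^{m_3})$, $m_1\ge m_2\ge m_3\ge1$ (i.e. $G/G'\cong C_{p^{m_1}}\times C_{p^{m_2}}\times C_{p^{m_3}}$). Choose $a_1,a_2,a_3\in G$ with $G/G'=\langle a_1G'\rangle\times\langle a_2G'\rangle\times\langle a_3G'\rangle$, $o(a_iG')=p^{m_i}$. Then $G=\langle a_1,a_2,a_3\rangle$, and $G'=\langle x,y,z\rangle$ with $x=[a_2,a_3]$, $y=[a_3,a_1]$, $z=[a_1,a_2]$. Write $a_i^{p^{m_i}}=x^{w_{i1}}y^{w_{i2}}z^{w_{i3}}$ for $i=1,2,3$. The $3\times3$ matrix $w(G)=(w_{ij})$ over $F_p$ is called a characteristic matrix of $G$, and $a_1,a_2,a_3$ a set of characteristic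 generators about $w(G)$ (the matrix depends on the choice of generators). A characteristic matrix together with $p,m_1,m_2,m_3$ determines $G$ up to isomorphism. *)

(* Defs.v *)
From mathcomp Require Import all_boot all_order all_algebra.
From mathcomp Require Import all_fingroup all_solvable.

Set Implicit Arguments.
Unset Strict Implicit.
Unset Printing Implicit Defensive.

Import GroupScope GRing.Theory.

(* 'm(G) is mathcomp's minimal number of generators of G.  The abelian type is
   the decreasing sequence of the orders of the cyclic factors. *)
Definition p_group_of_type (p m1 m2 m3 : nat) (gT : finGroupType)
    (G : {group gT}) : Prop :=
  [/\ p.-group G,
      'm(G) = 3,
      'Phi(G) \subset 'Z(G),
      p.-abelem G^`(1) /\ #|G^`(1)| = (p ^ 3)%N
    & abelian_type (G / G^`(1)) = [:: (p ^ m1)%N; (p ^ m2)%N; (p ^ m3)%N]].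

(* Rows and columns of w are indexed by 'I_3 = {0, 1, 2}.  An exponent
   w i j : 'F_p is used through its representative in {0, ..., p - 1}. *)
Definition characteristic_generators (p m1 m2 m3 : nat) (gT : finGroupType)
    (G : {group gT}) (a1 a2 a3 : gT) (w : 'M['F_p]_3) : Prop :=
  let i1 : 'I_3 := inord 0 in
  let i2 : 'I_3 := inord 1 in
  let i3 : 'I_3 := inord 2 in
  let x := [~ a2, a3] in
  let y := [~ a3, a1] in
  let z := [~ a1, a2] in
  [/\ [/\ a1 \in G, a2 \in G & a3 \in G],
      <[coset G^`(1) a1]> \x <[coset G^`(1) a2]> \x <[coset G^`(1) a3]>
        = G / G^`(1),
      [/\ #[coset G^`(1) a1] = (p ^ m1)%N,
          #[coset G^`(1) a2] = (p ^ m2)%N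
        & #[coset G^`(1) a3] = (p ^ m3)%N]
    & [/\ a1 ^+ (p ^ m1)%N = x ^+ w i1 i1 * y ^+ w i1 i2 * z ^+ w i1 i3,
          a2 ^+ (p ^ m2)%N = x ^+ w i2 i1 * y ^+ w i2 i2 * z ^+ w i2 i3
        & a3 ^+ (p ^ m3)%N = x ^+ w i3 i1 * y ^+ w i3 i2 * z ^+ w i3 i3]].

Definition characteristic_matrix (p m1 m2 m3 : nat) (gT : finGroupType)
    (G : {group gT}) (w : 'M['F_p]_3) : Prop :=
  exists a1 a2 a3 : gT, characteristic_generators m1 m2 m3 G a1 a2 a3 w.

Local Open Scope ring_scope.

(* The matrix unit with 1-based row and column indices i, j in {1, 2, 3}. *)
Definition e {p : nat} (i j : nat) : 'M['F_p]_3 :=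
  delta_mx (inord i.-1) (inord j.-1).

Definition in_1_eta (p : nat) (eta nu : 'F_p) : Prop :=
  nu = 1 \/ (odd p /\ nu = eta).

Inductive listed_matrix (p : nat) (eta : 'F_p) : 'M['F_p]_3 -> Prop :=
| G1 of odd p : listed_matrix eta (- e 1 2 + e 2 1 + e 3 3)
| G2 nu of odd p & in_1_eta eta nu :
    listed_matrix eta (nu *: e 1 1 - e 1 2 + e 2 1 + e 3 3)
| G3 nu of odd p & in_1_eta eta nu :
    listed_matrix eta (e 1 1 + nu *: e 2 2 + e 3 3)
| G4 (r : nat) of odd p & (1 <= r <= p - 2)%N :
    listed_matrix eta (e 1 1 - e 1 2 + e 2 1 + r%:R *: e 2 2 + e 3 3)
| H1 of odd p : listed_matrix eta (- e 1 2 + e 2 1)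
| H2 of odd p : listed_matrix eta (e 1 1 - e 1 2 + e 2 1)
| H3 nu of odd p & in_1_eta eta nu :
    listed_matrix eta (e 1 1 + nu *: e 2 2)
| H4 (r : nat) of odd p & (1 <= r <= p - 2)%N :
    listed_matrix eta (e 1 1 - e 1 2 + e 2 1 + r%:R *: e 2 2)
| G5 of p = 2%N : listed_matrix eta (e 1 2 + e 2 1 + e 3 3)
| G6 of p = 2%N : listed_matrix eta (e 1 1 + e 2 2 + e 3 3)
| G7 of p = 2%N : listed_matrix eta (e 1 1 + e 1 2 + e 2 2 + e 3 3)
| H5 of p = 2%N : listed_matrix eta (e 1 2 + e 2 1)
| H6 of p = 2%N : listed_matrix eta (e 1 1 + e 2 2)
| H7 of p = 2%N : listed_matrix eta (e 1 1 + e 1 2 + e 2 2)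
| G8 (t : 'F_p) of t != 0 : listed_matrix eta (e 1 1 + e 2 3 + t *: e 3 2)
| G9 : listed_matrix eta (e 1 2 + e 2 3 + e 3 1)
| H8 : listed_matrix eta (e 2 1 + e 3 3)
| H9 nu of in_1_eta eta nu : listed_matrix eta (nu *: e 2 2 + e 3 3)
| H10 : listed_matrix eta (e 2 1 + e 3 2)
| H11 : listed_matrix eta (e 2 2 + e 3 1)
| H12 : listed_matrix eta (e 1 1 + e 2 3)
| H13 : listed_matrix eta (e 1 2 + e 2 3)
| H14 : listed_matrix eta (e 2 3 + e 3 1)
| H15 (t : 'F_p) of t != 0 : listed_matrix eta (e 2 3 + t *: e 3 2)
| I1 : listed_matrix eta (e 3 3)
| I2 : listed_matrix eta (e 2 1)
| I3 : listed_matrix eta (e 2 2)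
| I4 : listed_matrix eta (e 3 1)
| I5 : listed_matrix eta 0
| I6 : listed_matrix eta (e 2 3).

(* Main.v *)
(* Characteristic generators of G can be changed exactly by
   a_i' = a_1^x_i1 a_2^x_i2 a_3^x_i3 (mod G'), where p^(m1 - m3) divides x_31 and
   x_32.  Since G has class 2, the p^m_i-th powers depend linearly on the
   exponents (m1 > m3 >= 1 makes 'C(p^m1, 2) divisible by p even for p = 2),
   while the commutators change by the cofactor matrix.  Writing w as a block
   matrix with blocks A (2 x 2), b (column), c (row), e (scalar), the changes of
   generators act by
     A' = (P A P^T + P b v^T) / (d det P),       b' = P b / det P,
     c' = (u (A P^T + b v^T) + d (c P^T + e v^T)) / (d det P),
     e' = (u b + d e) / det P
   with P invertible, d nonzero, u and v arbitrary.  The listed matrices are the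
   normal forms for this action: if b <> 0 one can reach b = e_2, e = 0; if b = 0
   the block A is a bilinear form up to congruence and scaling, decomposed into
   its symmetric and alternating parts. *)
Require Import Defs.
From mathcomp Require Import all_boot all_order all_algebra.
From mathcomp Require Import all_fingroup all_solvable.
From mathcomp Require Import ring zify.

Set Implicit Arguments.
Unset Strict Implicit.
Unset Printing Implicit Defensive.

Import GroupScope GRing.Theory.

(** [base_change] puts the cofactor matrix to the right of the new matrix, so no inverse occurs, and
    neither symmetry nor transitivity of the relation is established. Two devices replace them.
    Reduction works for any predicate [Q] closed under [base_change], later taken to be being a
    characteristic matrix of G: a chain of changes becomes a chain of implications. Uniqueness
    assumes a [base_change] in each direction, both obtained by comparing two systems of generators
    of one group after an isomorphism has moved the second matrix to G. An invariant then has to be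
    checked as a one-way implication only.

    The scalar [t] (the d of the formulas above) explains why the lists with e = 1 and e = 0 differ.
    For b = 0 the corner entry obeys t e = e' det P, so e = e' = 1 forces t = det P. For e = 0 the
    factor t is free and absorbs [nu] where the symmetric part has rank one; but then c can be
    cleared only through u, that is, modulo the rows of A. *)

Lemma expg_Fp_nat (p : nat) (gT : finGroupType) (x : gT) (n : nat) :
  prime p -> x ^+ p = 1 -> x ^+ (n%:R%R : 'F_p) = x ^+ n.
Proof. by move=> p_pr xp; rewrite val_Fp_nat // expg_mod. Qed.

Lemma commgMl (gT : finGroupType) (G : {group gT}) (x y z : gT) :
  {in G &, forall g h, [~ g, h] \in 'Z(G)} ->
  x \in G -> y \in G -> z \in G -> [~ x * y, z] = [~ x, z] * [~ y, z].
Proof.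
move=> cl Gx Gy Gz; rewrite commMgJ; congr (_ * _).
by apply/conjg_fixP/commgP; case/centerP: (cl _ _ Gx Gz) => _ cz; apply: cz.
Qed.

Lemma commgMr (gT : finGroupType) (G : {group gT}) (x y z : gT) :
  {in G &, forall g h, [~ g, h] \in 'Z(G)} ->
  x \in G -> y \in G -> z \in G -> [~ x, y * z] = [~ x, y] * [~ x, z].
Proof.
move=> cl Gx Gy Gz; rewrite commgMJ.
have -> : [~ x, y] ^ z = [~ x, y].
  by apply/conjg_fixP/commgP; case/centerP: (cl _ _ Gx Gy) => _ cz; apply: cz.
by case/centerP: (cl _ _ Gx Gy) => _ cz; apply/esym/cz; rewrite groupR.
Qed.

(** * Products of three cyclic groups, by counting *)

Lemma eq_factors3 (a b c i j k : nat) :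
  0 < i -> 0 < j -> 0 < k -> a <= i -> b <= j -> c <= k ->
  (i * j * k <= a * b * c)%N -> [/\ a = i, b = j & c = k].
Proof.
have lt1 (a' b' c' i' j' k' : nat) : 0 < j' -> 0 < k' -> b' <= j' -> c' <= k' ->
    (i' * j' * k' <= a' * b' * c')%N -> i' <= a'.
  move=> j0 k0 lb lc; case: (leqP i' a') => // lt le.
  have : (a' * b' * c' < i' * j' * k')%N; last by rewrite ltnNge le.
  rewrite -!mulnA (@leq_ltn_trans (a' * (j' * k'))%N) ?leq_mul2l ?leq_mul ?orbT //.
  by rewrite ltn_mul2r muln_gt0 j0 k0.
move=> i0 j0 k0 la lb lc le; split; apply/eqP; rewrite eqn_leq ?la ?lb ?lc /=.
- exact: (lt1 a b c i j k).
- by apply: (lt1 b a c j i k) => //; rewrite (mulnC j) (mulnC b).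
- apply: (lt1 c a b k i j) => //.
  by rewrite -[leqLHS]mulnA -[leqRHS]mulnA mulnC [leqRHS]mulnC.
Qed.

(** The cyclic subgroups have orders at most [i], [j], [k] and generate a group of order at least
    [i * j * k], so no order falls short and no factor overlaps the others. Upper bounds thus give
    exact orders and directness at once. *)
Lemma cycle_dprod3 (gT : finGroupType) (A : {group gT}) (x y z : gT)
    (i j k : nat) :
  abelian A -> A :=: <[x]> <*> <[y]> <*> <[z]> ->
  0 < i -> 0 < j -> 0 < k -> (i * j * k <= #|A|)%N ->
  x ^+ i = 1 -> y ^+ j = 1 -> z ^+ k = 1 ->
  <[x]> \x <[y]> \x <[z]> = A /\ [/\ #[x] = i, #[y] = j & #[z] = k].
Proof.
move=> abA defA i0 j0 k0 leA x1 y1 z1.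
have lei (u : gT) e : 0 < e -> u ^+ e = 1 -> #[u] <= e.
  by move=> e0 ue; apply: dvdn_leq => //; rewrite order_dvdn ue.
have sA : [/\ <[x]> \subset A, <[y]> \subset A & <[z]> \subset A].
  by rewrite defA; split; rewrite -?joingA ?joing_subl // joingA ?joing_subr //
    (subset_trans _ (joing_subl _ _)) // joing_subr.
case: sA => sx sy sz.
have cxy : <[y]> \subset 'C(<[x]>) by apply: sub_abelian_cent2 abA _ _.
have sxy : <[x]> * <[y]> \subset A by rewrite mul_subG.
have exy : <[x]> <*> <[y]> = <[x]> * <[y]> by rewrite cent_joinEr.
have cxyz : <[z]> \subset 'C(<[x]> <*> <[y]>).
  by apply: sub_abelian_cent2 abA _ _; rewrite ?exy.
have exyz : A :=: (<[x]> <*> <[y]>) * <[z]> by rewrite defA cent_joinEr.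
have l1 : #|<[x]> * <[y]>| <= #[x] * #[y].
  by rewrite !orderE mul_cardG leq_pmulr ?cardG_gt0.
have l2 : #|A| <= #|<[x]> * <[y]>| * #[z].
  by rewrite exyz -exy !orderE mul_cardG leq_pmulr ?cardG_gt0.
have [lx ly lz] := And3 (lei x i i0 x1) (lei y j j0 y1) (lei z k k0 z1).
have ox0 := order_gt0 x; have oy0 := order_gt0 y; have oz0 := order_gt0 z.
have lxyz : (i * j * k <= #[x] * #[y] * #[z])%N.
  by rewrite (leq_trans leA) // (leq_trans l2) // leq_mul2r l1 orbT.
have [ox oy oz] := eq_factors3 i0 j0 k0 lx ly lz lxyz.
rewrite ox oy oz in l1 l2 lxyz *.
split=> //; rewrite (dprodE cxy); last first.
  by apply: cardMg_TI; rewrite -!orderE ox oy -(leq_pmul2r k0) (leq_trans leA).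
rewrite -exy dprodE //.
apply: cardMg_TI; rewrite -exyz /= exy -orderE oz (leq_trans _ leA) //.
by rewrite leq_mul2r l1 orbT.
Qed.

Lemma cycle_dprod3_eq1 (gT : finGroupType) (A : {group gT}) (x y z : gT)
    (i j k : nat) :
  <[x]> \x <[y]> \x <[z]> = A -> x ^+ i * y ^+ j * z ^+ k = 1 ->
  x ^+ i = 1 /\ y ^+ j = 1.
Proof.
have E (B C : {set gT}) (D : {group gT}) g h : B \x C = D ->
    g \in B -> h \in C -> g * h = 1 -> g = 1.
  move=> defD Bg Ch gh.
  case/dprodP: (defD) => [[B' C' eB eC]] _ _ TI; rewrite eB eC in Bg Ch TI.
  apply/set1gP; rewrite -TI inE Bg /=.
  by rewrite -(groupMr g Ch) gh group1.
move=> defA e1; case/dprodP: (defA) => [[D _ defD _] _ _ _].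
have Xx : x ^+ i \in <[x]> by rewrite mem_cycle.
have Yy : y ^+ j \in <[y]> by rewrite mem_cycle.
have Zz : z ^+ k \in <[z]> by rewrite mem_cycle.
have e2 : x ^+ i * y ^+ j = 1.
  apply: E defA _ Zz e1; rewrite defD; case/dprodP: defD => _ <- _ _.
  exact: mem_mulg.
have x1 := E _ _ _ _ _ defD Xx Yy e2.
by split=> //; rewrite x1 mul1g in e2.
Qed.

(** * Matrices given by nine entries, within reach of [ring], and changes of generators *)

Definition mx3 (p : nat) (w11 w12 w13 w21 w22 w23 w31 w32 w33 : 'F_p) :
    'M['F_p]_3 :=
  \matrix_(i < 3, j < 3)
    nth 0%R [:: w11; w12; w13; w21; w22; w23; w31; w32; w33] (3 * i + j)%N.

Lemma mx3_surj (p : nat) (w : 'M['F_p]_3) :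
  exists w11 w12 w13 w21 w22 w23 w31 w32 w33,
    w = mx3 w11 w12 w13 w21 w22 w23 w31 w32 w33.
Proof.
exists (w (inord 0) (inord 0)), (w (inord 0) (inord 1)), (w (inord 0) (inord 2)),
       (w (inord 1) (inord 0)), (w (inord 1) (inord 1)), (w (inord 1) (inord 2)),
       (w (inord 2) (inord 0)), (w (inord 2) (inord 1)), (w (inord 2) (inord 2)).
apply/matrixP=> i j; rewrite mxE.
by case: i j => [[|[|[|//]]] ?] [[|[|[|//]]] ?] /=; congr (w _ _);
  apply: val_inj; rewrite /= inordK.
Qed.

Lemma mx3E (p : nat) (w11 w12 w13 w21 w22 w23 w31 w32 w33 : 'F_p) :
  let w := mx3 w11 w12 w13 w21 w22 w23 w31 w32 w33 in
  [/\ [/\ w (inord 0) (inord 0) = w11, w (inord 0) (inord 1) = w12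
       & w (inord 0) (inord 2) = w13],
      [/\ w (inord 1) (inord 0) = w21, w (inord 1) (inord 1) = w22
       & w (inord 1) (inord 2) = w23]
    & [/\ w (inord 2) (inord 0) = w31, w (inord 2) (inord 1) = w32
       & w (inord 2) (inord 2) = w33]].
Proof. by rewrite /= !mxE !inordK. Qed.

Lemma mx3_inj (p : nat) (v11 v12 v13 v21 v22 v23 v31 v32 v33
    w11 w12 w13 w21 w22 w23 w31 w32 w33 : 'F_p) :
  mx3 v11 v12 v13 v21 v22 v23 v31 v32 v33 =
    mx3 w11 w12 w13 w21 w22 w23 w31 w32 w33 ->
  [/\ [/\ v11 = w11, v12 = w12 & v13 = w13],
      [/\ v21 = w21, v22 = w22 & v23 = w23]
    & [/\ v31 = w31, v32 = w32 & v33 = w33]].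
Proof.
have := mx3E v11 v12 v13 v21 v22 v23 v31 v32 v33.
have := mx3E w11 w12 w13 w21 w22 w23 w31 w32 w33.
move=> [[W11 W12 W13] [W21 W22 W23] [W31 W32 W33]].
move=> [[V11 V12 V13] [V21 V22 V23] [V31 V32 V33]] E.
by rewrite E in V11 V12 V13 V21 V22 V23 V31 V32 V33; split; split; congruence.
Qed.

Lemma mx3_mul (p : nat) (a11 a12 a13 a21 a22 a23 a31 a32 a33
    b11 b12 b13 b21 b22 b23 b31 b32 b33 : 'F_p) :
  (mx3 a11 a12 a13 a21 a22 a23 a31 a32 a33 *m
   mx3 b11 b12 b13 b21 b22 b23 b31 b32 b33 =
   mx3 (a11 * b11 + a12 * b21 + a13 * b31) (a11 * b12 + a12 * b22 + a13 * b32)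
       (a11 * b13 + a12 * b23 + a13 * b33)
       (a21 * b11 + a22 * b21 + a23 * b31) (a21 * b12 + a22 * b22 + a23 * b32)
       (a21 * b13 + a22 * b23 + a23 * b33)
       (a31 * b11 + a32 * b21 + a33 * b31) (a31 * b12 + a32 * b22 + a33 * b32)
       (a31 * b13 + a32 * b23 + a33 * b33))%R.
Proof.
apply/matrixP=> i j; rewrite !mxE !big_ord_recl big_ord0 !mxE addr0.
by case: i j => [[|[|[|//]]] ?] [[|[|[|//]]] ?]; rewrite /= ?addrA.
Qed.

(* Modulo p the exponents of the change of generators form the matrix with rows
   (a, b, v1), (c, d, v2), (0, 0, t).  In the power map the column (v1, v2)
   disappears and (u1, u2), the exponents x_31 and x_32 divided by p^(m1 - m3),
   come in.  The right factor is the cofactor matrix, which expresses the new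
   commutators in the old ones. *)
Definition base_change (p : nat) (w w' : 'M['F_p]_3) : Prop :=
  exists a b c d u1 u2 v1 v2 t : 'F_p,
  [/\ (a * d - b * c != 0)%R, t != 0%R
    & (mx3 a b 0 c d 0 u1 u2 t *m w =
       w' *m mx3 (t * d) (- (t * c)) 0 (- (t * b)) (t * a) 0
               (b * v2 - v1 * d) (v1 * c - a * v2) (a * d - b * c))%R].

Lemma natr_Fp_neq0_id (p : nat) (gT : finGroupType) (x : gT) (i : nat) :
  prime p -> (i%:R : 'F_p)%R != 0%R -> x ^+ p = 1 -> x ^+ i = 1 -> x = 1.
Proof.
move=> p_pr i0 xp xi.
have /eqP co : coprime p i.
  by rewrite prime_coprime // (dvdn_pcharf (pchar_Fp p_pr)).
by apply/eqP; rewrite -order_eq1 -dvdn1 -co dvdn_gcd !order_dvdn xp xi !eqxx.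
Qed.

(** Cramer's rule in multiplicative form: the first relation to the power [d] times the second to
    the power [- b] cancels [y] and leaves [x] to the power of the determinant, a unit modulo p. *)
Lemma abelian_solve2 (p : nat) (gT : finGroupType) (x y : gT)
    (a b c d : 'F_p) :
  prime p -> commute x y -> x ^+ p = 1 -> y ^+ p = 1 ->
  x ^+ a * y ^+ b = 1 -> x ^+ c * y ^+ d = 1 -> (a * d - b * c != 0)%R -> x = 1.
Proof.
move=> p_pr cxy xp yp e1 e2 D0.
apply: (@natr_Fp_neq0_id p _ x (a * d + c * (- b)%R)%N) => //.
  by rewrite natrD !natrM !natr_Zp mulrN mulrC (mulrC c) mulrC.
have cXY i j : commute (x ^+ i) (y ^+ j).
  exact/commuteX/commute_sym/commuteX/commute_sym.
have : (x ^+ a * y ^+ b) ^+ d * (x ^+ c * y ^+ d) ^+ (- b)%R = 1.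
  by rewrite e1 e2 !expg1n mulg1.
rewrite !expgMn // -!expgM mulgA -(mulgA (x ^+ _)) -cXY mulgA -expgD -mulgA -expgD.
have -> : y ^+ (b * d + d * (- b)%R)%N = 1; last by rewrite mulg1.
apply/eqP; rewrite -(expg_Fp_nat _ p_pr yp) natrD !natrM !natr_Zp mulrN.
by rewrite (mulrC d) subrr.
Qed.

Definition comm_word (p : nat) (gT : finGroupType) (a1 a2 a3 : gT)
    (r s t : 'F_p) : gT :=
  [~ a2, a3] ^+ r * [~ a3, a1] ^+ s * [~ a1, a2] ^+ t.

(** * Generators and their changes in G; [m] is m1 = m2 and [n] is m3 *)

Section CharacteristicGenerators.

Variables (p m n : nat) (gT : finGroupType) (G : {group gT}).
Hypotheses (p_pr : prime p) (lt_nm : n < m) (n_gt0 : 0 < n).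
Hypothesis GT : p_group_of_type p m m n G.

Lemma der1_central c : c \in G^`(1) -> c \in 'Z(G) /\ c ^+ p = 1.
Proof.
case: GT => pG _ sPZ [/(abelemP p_pr)[_ ep] _] _ cG; split; last exact: ep.
by apply: (subsetP sPZ); rewrite (Phi_joing pG) (subsetP (joing_subl _ _)).
Qed.

Lemma commg_der1 : {in G &, forall g h, [~ g, h] \in G^`(1)}.
Proof. by move=> g h Gg Gh; rewrite mem_commg. Qed.

Lemma commg_central : {in G &, forall g h, [~ g, h] \in 'Z(G)}.
Proof. by move=> g h Gg Gh; case: (der1_central (commg_der1 Gg Gh)). Qed.

Lemma commg_expp : {in G &, forall g h, [~ g, h] ^+ p = 1}.
Proof. by move=> g h Gg Gh; case: (der1_central (commg_der1 Gg Gh)). Qed.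

Lemma expp_Phi g : g \in G -> g ^+ p \in 'Phi(G).
Proof.
case: GT => pG _ _ _ _ Gg; rewrite (Phi_joing pG).
apply: (subsetP (joing_subr _ _)).
by rewrite -[p]expn1 Mho_p_elt // (mem_p_elt pG).
Qed.

Lemma central_expp g : g \in G -> g ^+ p \in 'Z(G).
Proof.
by case: GT => _ _ sPZ _ _ Gg; apply: (subsetP sPZ); apply: expp_Phi.
Qed.

Lemma central_commute c g : c \in 'Z(G) -> g \in G -> commute c g.
Proof. by case/centerP=> _ cz; apply: cz. Qed.

Lemma commg_expl i : {in G &, forall g h, [~ g ^+ i, h] = [~ g, h] ^+ i}.
Proof.
move=> g h Gg Gh; apply: commXg; apply/commute_sym.
by apply: central_commute => //; apply: commg_central.
Qed.

Lemma commg_expr i : {in G &, forall g h, [~ g, h ^+ i] = [~ g, h] ^+ i}.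
Proof.
move=> g h Gg Gh; apply: commgX; apply/commute_sym.
by apply: central_commute => //; apply: commg_central.
Qed.

(* For p = 2 the exponent must be at least 2, so that p divides 'C(p ^ m, 2). *)
Lemma expgM_class2 : {in G &, forall g h,
  (g * h) ^+ (p ^ m) = g ^+ (p ^ m) * h ^+ (p ^ m)}.
Proof.
move=> g h Gg Gh; have Zc := commg_central Gh Gg.
rewrite expMg_Rmul; first last.
- by apply/commute_sym/central_commute.
- by apply/commute_sym/central_commute.
have -> : [~ h, g] ^+ 'C(p ^ m, 2) = 1; last by rewrite mulg1.
apply/eqP; rewrite -order_dvdn; apply: (@dvdn_trans p).
  by rewrite order_dvdn commg_expp.
have m_gt1 : 1 < m by apply: leq_ltn_trans lt_nm.
rewrite -(@dvdn_pmul2l 2) // -[(2 * 'C(_, _))%N](mul_bin_diag _ 1) bin1.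
case: (eqVneq p 2%N) => [-> | p_neq2].
  by rewrite dvdn_mulr // (@dvdn_exp2l 2 2 m).
rewrite Gauss_dvd; last by rewrite prime_coprime // dvdn_prime2 // eq_sym.
rewrite andbC dvdn_mulr ?dvdn_exp ?(ltnW m_gt1) //= dvdn2 oddM negb_and.
by case: (p ^ m)%N => [|k] //=; case: (odd k).
Qed.

Section Words.

Variables a1 a2 a3 : gT.
Hypotheses (Ga1 : a1 \in G) (Ga2 : a2 \in G) (Ga3 : a3 \in G).

Local Notation K := (comm_word (p := p) a1 a2 a3).

Lemma comm_word_der1 r s t : K r s t \in G^`(1).
Proof. by rewrite !groupM ?groupX ?commg_der1. Qed.

Lemma comm_wordD r s t r' s' t' :
  K r s t * K r' s' t' = K (r + r')%R (s + s')%R (t + t')%R.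
Proof.
have Kn (g h : gT) (i j : 'F_p) : g \in G -> h \in G ->
  [~ g, h] ^+ (i + j)%R = [~ g, h] ^+ i * [~ g, h] ^+ j.
  move=> Gg Gh; rewrite -expgD -(@expg_Fp_nat p _ _ (i + j)) ?commg_expp //.
  by rewrite natrD !natr_Zp.
have cc (g h g' h' : gT) i j : g \in G -> h \in G -> g' \in G -> h' \in G ->
  commute ([~ g, h] ^+ i) ([~ g', h'] ^+ j).
  move=> *; apply: commuteX; apply/commute_sym/commuteX/commute_sym.
  by apply: central_commute; [apply: commg_central | rewrite groupR].
rewrite /comm_word !Kn // -!mulgA; congr (_ * _).
rewrite (mulgA ([~ a1, a2] ^+ t) ([~ a2, a3] ^+ r')) (cc a1 a2 a2 a3) // -mulgA.
rewrite (mulgA ([~ a3, a1] ^+ s) ([~ a2, a3] ^+ r')) (cc a3 a1 a2 a3) // -mulgA.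
do 2!congr (_ * _); rewrite (mulgA ([~ a1, a2] ^+ t)) (cc a1 a2 a3 a1) //.
by rewrite -mulgA.
Qed.

Lemma comm_word0 : K 0%R 0%R 0%R = 1.
Proof. by rewrite /comm_word !expg0 !mulg1. Qed.

Lemma comm_wordX r s t i :
  K r s t ^+ i = K (i%:R * r)%R (i%:R * s)%R (i%:R * t)%R.
Proof.
elim: i => [|i IH]; first by rewrite !mul0r comm_word0.
by rewrite expgS IH comm_wordD -[(i.+1)%:R%R]natr1 !mulrDl !mul1r ![(_ * _ + _)%R]addrC.
Qed.

Lemma comm_wordV r s t : (K r s t)^-1 = K (- r)%R (- s)%R (- t)%R.
Proof. by apply/eqP; rewrite eq_invg_mul comm_wordD !subrr comm_word0. Qed.

Lemma comm_word_id : [/\ [~ a2, a3] = K 1%R 0%R 0%R,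
  [~ a3, a1] = K 0%R 1%R 0%R & [~ a1, a2] = K 0%R 0%R 1%R].
Proof. by rewrite /comm_word !expg0 !expg1 !mulg1 !mul1g. Qed.

(** Commutators are bilinear in class 2 and ignore the central factors [c] and [d]. With the cyclic
    choice of x, y, z the coordinates are the cross product of the exponent vectors; this is where
    the cofactor matrix comes from. *)
Lemma commg_words (n1 n2 n3 k1 k2 k3 : nat) c d :
  c \in G^`(1) -> d \in G^`(1) ->
  [~ a1 ^+ n1 * a2 ^+ n2 * a3 ^+ n3 * c, a1 ^+ k1 * a2 ^+ k2 * a3 ^+ k3 * d] =
  K (n2%:R * k3%:R - n3%:R * k2%:R)%R (n3%:R * k1%:R - n1%:R * k3%:R)%R
    (n1%:R * k2%:R - n2%:R * k1%:R)%R.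
Proof.
move=> Gc Gd; have sG' := subsetP (der_sub 1 G).
have cZ g c' : g \in G -> c' \in G^`(1) -> [~ g, c'] = 1.
  move=> Gg /der1_central[Zc _]; apply/eqP/commgP/commute_sym.
  exact: central_commute.
have Zc g c' : g \in G -> c' \in G^`(1) -> [~ c', g] = 1.
  by move=> Gg /cZ c1; rewrite -invgR c1 ?invg1.
have cl := commg_central.
have [Ex Ey Ez] := comm_word_id.
have E1 : [~ a1, a1 ^+ k1 * a2 ^+ k2 * a3 ^+ k3 * d] =
  K 0%R (- k3%:R)%R k2%:R%R.
  rewrite !(commgMr cl) ?groupM ?groupX // ?sG' //.
  rewrite !commg_expr // commgg expg1n -(invgR a3) Ey Ez cZ // mul1g mulg1.
  by rewrite comm_wordV !comm_wordX !comm_wordD; congr K; ring.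
have E2 : [~ a2, a1 ^+ k1 * a2 ^+ k2 * a3 ^+ k3 * d] =
  K k3%:R%R 0%R (- k1%:R)%R.
  rewrite !(commgMr cl) ?groupM ?groupX // ?sG' //.
  rewrite !commg_expr // commgg expg1n -(invgR a1) Ex Ez cZ // mulg1 mulg1.
  by rewrite comm_wordV !comm_wordX !comm_wordD; congr K; ring.
have E3 : [~ a3, a1 ^+ k1 * a2 ^+ k2 * a3 ^+ k3 * d] =
  K (- k2%:R)%R k1%:R%R 0%R.
  rewrite !(commgMr cl) ?groupM ?groupX // ?sG' //.
  rewrite !commg_expr // commgg expg1n -(invgR a2) Ex Ey cZ // mulg1 mulg1.
  by rewrite comm_wordV !comm_wordX !comm_wordD; congr K; ring.
rewrite !(commgMl cl) ?groupM ?groupX // ?sG' //.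
rewrite !commg_expl ?groupM ?groupX // ?sG' // E1 E2 E3.
rewrite Zc ?groupM ?groupX // ?sG' // mulg1 !comm_wordX !comm_wordD.
by congr K; ring.
Qed.

End Words.

Lemma der1_nG g : g \in G -> g \in 'N(G^`(1)).
Proof. exact: (subsetP (der_norm 1 G)). Qed.

Lemma card_abelianization : #|G / G^`(1)| = (p ^ m * p ^ m * p ^ n)%N.
Proof.
case: GT => _ _ _ _ Gty.
have [b defG ob] := abelian_structure (sub_der1_abelian (subxx G^`(1))).
have := bigdprod_card defG; rewrite Gty in ob.
case: b ob defG => [|b1 [|b2 [|b3 [|b4 b]]]] //= [o1 o2 o3] _.
by rewrite !big_cons big_nil -!orderE o1 o2 o3 muln1 mulnA => <-.
Qed.

Definition normal_words (a1 a2 a3 : gT) : Prop :=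
  forall g, g \in G -> exists i j k c,
    c \in G^`(1) /\ g = a1 ^+ i * a2 ^+ j * a3 ^+ k * c.

Lemma dprod_normal_words a1 a2 a3 :
  a1 \in G -> a2 \in G -> a3 \in G ->
  <[coset G^`(1) a1]> \x <[coset G^`(1) a2]> \x <[coset G^`(1) a3]>
    = G / G^`(1) -> normal_words a1 a2 a3.
Proof.
move=> Ga1 Ga2 Ga3 defG g Gg.
have [y [z [Yy Zz Eg _]]] := mem_dprod defG (mem_quotient _ Gg).
case/dprodP: defG => [[H _ defH _] _ _ _].
rewrite defH in Yy.
have [u [v [/cycleP[i ->] /cycleP[j ->] Ey _]]] := mem_dprod defH Yy.
case/cycleP: Zz Eg => k -> Eg; rewrite {}Ey in Eg.
have [] := @kercoset_rcoset _ _ g (a1 ^+ i * a2 ^+ j * a3 ^+ k) (der1_nG Gg).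
- by apply: der1_nG; rewrite !groupM ?groupX.
- by rewrite Eg !morphM ?morphX ?groupM ?groupX ?der1_nG.
move=> c cG' ->; exists i, j, k, c; split=> //.
by apply: central_commute; [case: (der1_central cG') | rewrite !groupM ?groupX].
Qed.

Section WordCoordinates.

Variables a1 a2 a3 : gT.
Hypotheses (Ga1 : a1 \in G) (Ga2 : a2 \in G) (Ga3 : a3 \in G).
Hypothesis nw : normal_words a1 a2 a3.

Local Notation K := (comm_word (p := p) a1 a2 a3).

(** By [comm_wordD] the words form a subgroup, and by [commg_words] it contains every commutator. *)
Lemma comm_word_surj c : c \in G^`(1) -> exists r s t, c = K r s t.
Proof.
pose A := [set K u.1.1 u.1.2 u.2 | u : 'F_p * 'F_p * 'F_p].
have gA : group_set A.
  apply/group_setP; split.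
    by apply/imsetP; exists (0%R, 0%R, 0%R); rewrite //= comm_word0.
  move=> _ _ /imsetP[[[r s] t] _ ->] /imsetP[[[r' s'] t'] _ ->] /=.
  apply/imsetP; exists (r + r', s + s', t + t')%R; rewrite //=.
  by rewrite comm_wordD.
suff sA : G^`(1) \subset Group gA.
  by move/(subsetP sA)/imsetP => [[[r s] t] _ ->]; exists r, s, t.
rewrite gen_subG; apply/subsetP=> _ /imset2P[g h Gg Gh ->].
have [i [j [k [d [Gd ->]]]]] := nw Gg.
have [i' [j' [k' [d' [Gd' ->]]]]] := nw Gh.
by rewrite commg_words //; apply/imsetP; eexists (_, _, _).
Qed.

(** Here |G'| = p^3 enters: a surjection from a set of p^3 triples onto G' is injective. This makes
    exponents comparable entry by entry. *)
Lemma comm_word_inj r s t r' s' t' :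
  K r s t = K r' s' t' -> [/\ r = r', s = s' & t = t'].
Proof.
pose f (u : 'F_p * 'F_p * 'F_p) := K u.1.1 u.1.2 u.2.
have cG : #|G^`(1)| = (p ^ 3)%N by case: GT => _ _ _ [].
have : #|f @: setT| = #|[set: 'F_p * 'F_p * 'F_p]|.
  have -> : #|[set: 'F_p * 'F_p * 'F_p]| = #|G^`(1)|.
    by rewrite cardsT !card_prod !card_Fp // cG !expnS expn0 muln1 mulnA.
  apply: eq_card => c; apply/imsetP/idP => [[u _ ->] | ]; first exact: comm_word_der1.
  by case/comm_word_surj=> [x [y [z ->]]]; exists (x, y, z).
move/eqP/imset_injP => injf E.
by have [] := injf (r, s, t) (r', s', t') (in_setT _) (in_setT _) E.
Qed.

End WordCoordinates.

(** Generation and the power relations suffice: the relations bound the orders modulo G', and the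
    known order of G/G' makes [cycle_dprod3] applicable. *)
Lemma characteristic_generatorsI (a1 a2 a3 : gT) (w : 'M['F_p]_3) :
  a1 \in G -> a2 \in G -> a3 \in G ->
  G \subset <[a1]> <*> <[a2]> <*> <[a3]> ->
  a1 ^+ (p ^ m) = comm_word a1 a2 a3
    (w (inord 0) (inord 0)) (w (inord 0) (inord 1)) (w (inord 0) (inord 2)) ->
  a2 ^+ (p ^ m) = comm_word a1 a2 a3
    (w (inord 1) (inord 0)) (w (inord 1) (inord 1)) (w (inord 1) (inord 2)) ->
  a3 ^+ (p ^ n) = comm_word a1 a2 a3
    (w (inord 2) (inord 0)) (w (inord 2) (inord 1)) (w (inord 2) (inord 2)) ->
  characteristic_generators m m n G a1 a2 a3 w.
Proof.
move=> Ga1 Ga2 Ga3 sG E1 E2 E3.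
have expp1 g k : g \in G -> g ^+ k \in G^`(1) -> coset G^`(1) g ^+ k = 1.
  by move=> Gg gk; rewrite -morphX ?der1_nG //; apply: coset_id.
have defQ : G / G^`(1) = <[coset G^`(1) a1]> <*> <[coset G^`(1) a2]>
                                         <*> <[coset G^`(1) a3]>.
  transitivity ((<[a1]> <*> <[a2]> <*> <[a3]>) / G^`(1)).
    apply: (congr1 (fun B : {set gT} => B / _)).
    by apply/eqP; rewrite eqEsubset sG !join_subG !cycle_subG Ga1 Ga2 Ga3.
  have [N1 N2 N3] := And3 (der1_nG Ga1) (der1_nG Ga2) (der1_nG Ga3).
  by rewrite !quotientY ?quotient_cycle ?join_subG ?cycle_subG ?N1 ?N2.
have pm i : (0 < p ^ i)%N by rewrite expn_gt0 prime_gt0.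
have [|||||dQ o] := cycle_dprod3 _ defQ (pm m) (pm m) (pm n).
- exact: sub_der1_abelian.
- by rewrite card_abelianization.
- by apply: expp1; rewrite // E1 comm_word_der1.
- by apply: expp1; rewrite // E2 comm_word_der1.
- by apply: expp1; rewrite // E3 comm_word_der1.
by split.
Qed.


Lemma characteristic_generators_words a1 a2 a3 (w : 'M['F_p]_3) :
  characteristic_generators m m n G a1 a2 a3 w -> normal_words a1 a2 a3.
Proof. by case=> [[Ga1 Ga2 Ga3] defQ _ _]; apply: dprod_normal_words. Qed.

Lemma characteristic_generators_exist :
  exists (a1 a2 a3 : gT) (w : 'M['F_p]_3),
    characteristic_generators m m n G a1 a2 a3 w.
Proof.
case: GT => _ _ _ _ Gty.
have [b defQ ob] := abelian_structure (sub_der1_abelian (subxx G^`(1))).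
rewrite Gty in ob.
case: b ob defQ => [|b1 [|b2 [|b3 [|b4 b]]]] //= [o1 o2 o3].
rewrite !big_cons big_nil dprodg1 dprodA => defQ.
have sQ : [/\ b1 \in G / G^`(1), b2 \in G / G^`(1) & b3 \in G / G^`(1)].
  case/dprodP: (defQ) => [[D _ defD _] <- _ _]; rewrite defD.
  case/dprodP: defD => _ <- _ _.
  have M g h k : g \in <[b1]> -> h \in <[b2]> -> k \in <[b3]> ->
      g * h * k \in <[b1]> * <[b2]> * <[b3]>.
    by move=> *; rewrite !mem_mulg.
  split; first by have := M b1 1 1; rewrite !mulg1; apply; rewrite ?cycle_id.
    by have := M 1 b2 1; rewrite mul1g mulg1; apply; rewrite ?cycle_id.
  by have := M 1 1 b3; rewrite !mul1g; apply; rewrite ?cycle_id.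
case: sQ => /morphimP[a1 _ Ga1 E1] /morphimP[a2 _ Ga2 E2] /morphimP[a3 _ Ga3 E3].
rewrite /= in E1 E2 E3; rewrite {}E1 {}E2 {}E3 in o1 o2 o3 defQ.
have nw := dprod_normal_words Ga1 Ga2 Ga3 defQ.
have inG' g k : g \in G -> #[coset G^`(1) g] = k -> g ^+ k \in G^`(1).
  move=> Gg og; apply: coset_idr; first by rewrite groupX ?der1_nG.
  by rewrite morphX ?der1_nG // -og expg_order.
have [w11 [w12 [w13 W1]]] := comm_word_surj Ga1 Ga2 Ga3 nw (inG' _ _ Ga1 o1).
have [w21 [w22 [w23 W2]]] := comm_word_surj Ga1 Ga2 Ga3 nw (inG' _ _ Ga2 o2).
have [w31 [w32 [w33 W3]]] := comm_word_surj Ga1 Ga2 Ga3 nw (inG' _ _ Ga3 o3).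
exists a1, a2, a3, (mx3 w11 w12 w13 w21 w22 w23 w31 w32 w33).
have [[W11 W12 W13] [W21 W22 W23] [W31 W32 W33]] :=
  mx3E w11 w12 w13 w21 w22 w23 w31 w32 w33.
by split=> //; rewrite W11 W12 W13 W21 W22 W23 W31 W32 W33.
Qed.

Lemma comm_word_change a1 a2 a3 b1 b2 b3
    (x1 x2 x3 y1 y2 y3 z1 z2 z3 r s t : 'F_p) :
  a1 \in G -> a2 \in G -> a3 \in G ->
  [~ b2, b3] = comm_word a1 a2 a3 x1 x2 x3 ->
  [~ b3, b1] = comm_word a1 a2 a3 y1 y2 y3 ->
  [~ b1, b2] = comm_word a1 a2 a3 z1 z2 z3 ->
  comm_word b1 b2 b3 r s t =
  comm_word a1 a2 a3 (r * x1 + s * y1 + t * z1)%R (r * x2 + s * y2 + t * z2)%R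
    (r * x3 + s * y3 + t * z3)%R.
Proof.
move=> Ga1 Ga2 Ga3 Ex Ey Ez; rewrite {1}/comm_word Ex Ey Ez.
by rewrite !comm_wordX // !comm_wordD // !natr_Zp.
Qed.

Section Powers.

Variables (a1 a2 a3 : gT).
Variables w11 w12 w13 w21 w22 w23 w31 w32 w33 : 'F_p.
Hypotheses (Ga1 : a1 \in G) (Ga2 : a2 \in G) (Ga3 : a3 \in G).

Local Notation K := (comm_word (p := p) a1 a2 a3).
Hypotheses (A1 : a1 ^+ (p ^ m) = K w11 w12 w13)
  (A2 : a2 ^+ (p ^ m) = K w21 w22 w23) (A3 : a3 ^+ (p ^ n) = K w31 w32 w33).

Lemma power_word i j k c : c \in G^`(1) ->
  (a1 ^+ i * a2 ^+ j * a3 ^+ k * c) ^+ (p ^ m) =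
  K (i%:R * w11 + j%:R * w21)%R (i%:R * w12 + j%:R * w22)%R
    (i%:R * w13 + j%:R * w23)%R.
Proof.
move=> cG'; have Gc := subsetP (der_sub 1 G) _ cG'.
have p1 d e : d \in G^`(1) -> 0 < e -> d ^+ (p ^ e) = 1.
  move=> /der1_central[_ dp] e0.
  by rewrite -(prednK e0) expnS expgM dp expg1n.
have m0 : 0 < m by apply: leq_ltn_trans lt_nm.
rewrite !expgM_class2 ?groupM ?groupX // (p1 c) // mulg1.
(* Since n < m, this is a power of the p-th power of [a3 ^+ (p ^ n)], an element of G', which has
   exponent p. *)
have -> : (a3 ^+ k) ^+ (p ^ m) = 1.
  rewrite -expgM mulnC -(subnK (ltnW lt_nm)) addnC expnD expgM expgM A3.
  by rewrite p1 ?expg1n ?subn_gt0 // comm_word_der1.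
by rewrite mulg1 -!expgM ![(_ * p ^ m)%N]mulnC !expgM A1 A2 !comm_wordX // comm_wordD.
Qed.

(** [expgM_class2] does not cover the power p^n, since n = 1 with p = 2 is allowed. Instead, the
    first two factors are powers of p-th powers, hence central, and no commutator correction
    arises. *)
Lemma power_word3 i j k c : c \in G^`(1) ->
  (a1 ^+ (p ^ (m - n) * i) * a2 ^+ (p ^ (m - n) * j) * a3 ^+ k * c) ^+ (p ^ n) =
  K (i%:R * w11 + j%:R * w21 + k%:R * w31)%R
    (i%:R * w12 + j%:R * w22 + k%:R * w32)%R
    (i%:R * w13 + j%:R * w23 + k%:R * w33)%R.
Proof.
move=> cG'; have Gc := subsetP (der_sub 1 G) _ cG'.
have [Zc cp] := der1_central cG'.
have Zp g l : g \in G -> g ^+ (p ^ (m - n) * l) \in 'Z(G).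
  move=> Gg; have mn : 0 < m - n by rewrite subn_gt0.
  by rewrite -(prednK mn) expnS -mulnA expgM groupX // central_expp.
have Zc12 := groupM (Zp _ i Ga1) (Zp _ j Ga2).
rewrite expgMn; last by apply/commute_sym/central_commute; rewrite ?groupM ?groupX.
have -> : c ^+ (p ^ n) = 1 by rewrite -(prednK n_gt0) expnS expgM cp expg1n.
rewrite mulg1.
rewrite expgMn; last by apply: central_commute; rewrite ?groupX.
rewrite expgMn; last by apply: central_commute (Zp _ _ Ga1) _; rewrite groupX.
have E (g : gT) (l : nat) : (g ^+ (p ^ (m - n) * l)) ^+ (p ^ n) = (g ^+ (p ^ m)) ^+ l.
  by rewrite -!expgM mulnAC -expnD subnK // ltnW.
by rewrite !E -(expgM a3) (mulnC k) (expgM a3) A1 A2 A3 !comm_wordX // !comm_wordD.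
Qed.

End Powers.


Lemma base_change_of_generators a1 a2 a3 b1 b2 b3 (w w' : 'M['F_p]_3) :
  characteristic_generators m m n G a1 a2 a3 w ->
  characteristic_generators m m n G b1 b2 b3 w' -> base_change w w'.
Proof.
move=> Ca Cb; have nwa := characteristic_generators_words Ca.
have nwb := characteristic_generators_words Cb.
case: Ca => [[Ga1 Ga2 Ga3] defQ [oa1 oa2 _] [A1 A2 A3]].
case: Cb => [[Gb1 Gb2 Gb3] _ [_ _ ob3] [B1 B2 B3]].
have [w11 [w12 [w13 [w21 [w22 [w23 [w31 [w32 [w33 Ew]]]]]]]]] := mx3_surj w.
have [v11 [v12 [v13 [v21 [v22 [v23 [v31 [v32 [v33 Ev]]]]]]]]] := mx3_surj w'.
rewrite {w}Ew in A1 A2 A3 *; rewrite {w'}Ev in B1 B2 B3 *.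
move: A1 A2 A3 B1 B2 B3.
have [[-> -> ->] [-> -> ->] [-> -> ->]] := mx3E w11 w12 w13 w21 w22 w23 w31 w32 w33.
have [[-> -> ->] [-> -> ->] [-> -> ->]] := mx3E v11 v12 v13 v21 v22 v23 v31 v32 v33.
move=> A1 A2 A3 B1 B2 B3.
have [i1 [j1 [k1 [c1 [c1G Eb1]]]]] := nwa _ Gb1.
have [i2 [j2 [k2 [c2 [c2G Eb2]]]]] := nwa _ Gb2.
have [i3 [j3 [k3 [c3 [c3G Eb3]]]]] := nwa _ Gb3.
(* Modulo G', [b3] has order p^n, so directness makes [a1 ^+ (i3 * p ^ n)] trivial there, and p^m
   divides [i3 * p ^ n]; likewise for [j3]. *)
have [di dj] : p ^ (m - n) %| i3 /\ p ^ (m - n) %| j3.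
  have abQ : abelian (G / G^`(1)) by apply: sub_der1_abelian.
  have cQ g h : g \in G -> h \in G ->
      commute (coset G^`(1) g) (coset G^`(1) h).
    by move=> Gg Gh; apply: (centsP abQ); apply: mem_quotient.
  have : coset G^`(1) b3 ^+ (p ^ n) = 1 by rewrite -ob3 expg_order.
  rewrite Eb3 !morphM ?groupM ?groupX ?der1_nG // ?(subsetP (der_sub 1 G)) //=.
  rewrite (coset_id c3G) mulg1.
  rewrite expgMn; last by rewrite -morphM ?groupM ?groupX ?der1_nG //;
    apply: cQ; rewrite ?groupM ?groupX.
  rewrite expgMn; last by apply: cQ; rewrite ?groupX.
  rewrite !morphX ?der1_nG // -!expgM => /(cycle_dprod3_eq1 defQ) [/eqP e1 /eqP e2].
  rewrite -order_dvdn in e1; rewrite -order_dvdn in e2.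
  rewrite oa1 in e1; rewrite oa2 in e2; move: e1 e2.
  have -> : (p ^ m = p ^ (m - n) * p ^ n)%N by rewrite -expnD subnK // ltnW.
  by rewrite !dvdn_pmul2r ?expn_gt0 ?prime_gt0.
have pz i : p ^ (m - n) %| i -> (i%:R : 'F_p)%R = 0%R.
  move=> di'; apply/eqP; rewrite -(dvdn_pcharf (pchar_Fp p_pr)).
  by apply: dvdn_trans di'; rewrite dvdn_exp // subn_gt0.
have i30 := pz _ di; have j30 := pz _ dj.
have Ex : [~ b2, b3] = comm_word (p := p) a1 a2 a3 (k3%:R * j2%:R)%R
    (- (k3%:R * i2%:R))%R 0%R.
  by rewrite Eb2 Eb3 commg_words // i30 j30; congr comm_word; ring.
have Ey : [~ b3, b1] = comm_word (p := p) a1 a2 a3 (- (k3%:R * j1%:R))%R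
    (k3%:R * i1%:R)%R 0%R.
  by rewrite Eb1 Eb3 commg_words // i30 j30; congr comm_word; ring.
have Ez : [~ b1, b2] = comm_word (p := p) a1 a2 a3 (j1%:R * k2%:R - k1%:R * j2%:R)%R
    (k1%:R * i2%:R - i1%:R * k2%:R)%R (i1%:R * j2%:R - j1%:R * i2%:R)%R.
  by rewrite Eb1 Eb2 commg_words.
have Kc r s t := comm_word_change r s t Ga1 Ga2 Ga3 Ex Ey Ez.
have Kb0 (r s t : 'F_p) : comm_word b1 b2 b3 r s t = comm_word (p := p) a1 a2 a3 0%R 0%R 0%R ->
    [/\ r = 0%R, s = 0%R & t = 0%R].
  rewrite comm_word0 -(comm_word0 b1 b2 b3) //.
  exact: comm_word_inj.
(* Either condition makes the commutator of [b2] and [b3] trivial, although it is a nonzero word in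
   the new coordinates. *)
have x0 : (k3%:R = 0 :> 'F_p)%R \/
    (i2%:R = 0 :> 'F_p)%R /\ (j2%:R = 0 :> 'F_p)%R -> False.
  move=> H; have [|/eqP] := Kb0 1%R 0%R 0%R; last by rewrite oner_eq0.
  rewrite Kc; case: H => [-> | [-> ->]]; congr comm_word; ring.
exists i1%:R%R, j1%:R%R, i2%:R%R, j2%:R%R, (i3 %/ p ^ (m - n))%:R%R,
  (j3 %/ p ^ (m - n))%:R%R, k1%:R%R, k2%:R%R, k3%:R%R; split.
(* The columns (i1, i2) and (j1, j2), read as words in the new commutators, have old coordinates (t
   D, 0, 0) and (0, t D, 0), with t = [k3] and D the determinant. If D = 0 both words are trivial,
   so [i2] and [j2] vanish modulo p. *)
- apply/eqP => D0; apply: x0; right.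
  have [|_ i20 _] := Kb0 i1%:R%R i2%:R%R 0%R.
  + rewrite Kc; congr comm_word; last by ring.
      by transitivity (k3%:R * (i1%:R * j2%:R - j1%:R * i2%:R) : 'F_p)%R;
        [ring | rewrite D0 mulr0].
    by ring.
  have [|_ j20 _] := Kb0 j1%:R%R j2%:R%R 0%R; last by [].
  rewrite Kc; congr comm_word; last by ring.
    by ring.
  by transitivity (k3%:R * (i1%:R * j2%:R - j1%:R * i2%:R) : 'F_p)%R;
    [ring | rewrite D0 mulr0].
- by apply/eqP => k30; apply: x0; left.
move: B1 B2 B3; rewrite -/(comm_word b1 b2 b3 v11 v12 v13).
rewrite -/(comm_word b1 b2 b3 v21 v22 v23) -/(comm_word b1 b2 b3 v31 v32 v33) !Kc.
rewrite {1}Eb1 (power_word Ga1 Ga2 Ga3 A1 A2 A3) // => /comm_word_inj-/(_ Ga1 Ga2 Ga3 nwa)[e11 e12 e13].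
rewrite {1}Eb2 (power_word Ga1 Ga2 Ga3 A1 A2 A3) // => /comm_word_inj-/(_ Ga1 Ga2 Ga3 nwa)[e21 e22 e23].
have Eb3' := Eb3; rewrite -(divnK di) -(divnK dj) ![(_ * p ^ (m - n))%N]mulnC in Eb3'.
rewrite {1}Eb3' (power_word3 Ga1 Ga2 Ga3 A1 A2 A3) // => /comm_word_inj-/(_ Ga1 Ga2 Ga3 nwa)[e31 e32 e33].
rewrite !mx3_mul -e11 -e12 -e13 -e21 -e22 -e23 -e31 -e32 -e33.
by congr mx3; ring.
Qed.

Lemma base_change_characteristic (w w' : 'M['F_p]_3) :
  characteristic_matrix m m n G w -> base_change w w' ->
  characteristic_matrix m m n G w'.
Proof.
case=> [a1 [a2 [a3 Ca]]] [a [b [c [d [u1 [u2 [v1 [v2 [t [D0 t0 E]]]]]]]]]].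
have nw := characteristic_generators_words Ca.
case: Ca => [[Ga1 Ga2 Ga3] _ _ [A1 A2 A3]].
have [w11 [w12 [w13 [w21 [w22 [w23 [w31 [w32 [w33 Ew]]]]]]]]] := mx3_surj w.
have [v11 [v12 [v13 [v21 [v22 [v23 [v31 [v32 [v33 Ev]]]]]]]]] := mx3_surj w'.
rewrite {w}Ew in A1 A2 A3 E; rewrite {w'}Ev in E *.
move: A1 A2 A3.
have [[-> -> ->] [-> -> ->] [-> -> ->]] := mx3E w11 w12 w13 w21 w22 w23 w31 w32 w33.
move=> A1 A2 A3.
(* The trailing [1] is the factor from G' in the shape expected by [commg_words], [power_word] and
   [power_word3]. *)
pose b1 := a1 ^+ a * a2 ^+ b * a3 ^+ v1 * 1.
pose b2 := a1 ^+ c * a2 ^+ d * a3 ^+ v2 * 1.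
pose b3 := a1 ^+ (p ^ (m - n) * u1) * a2 ^+ (p ^ (m - n) * u2) * a3 ^+ t * 1.
have Gb1 : b1 \in G by rewrite !groupM ?groupX.
have Gb2 : b2 \in G by rewrite !groupM ?groupX.
have Gb3 : b3 \in G by rewrite !groupM ?groupX.
have mn : 0 < m - n by rewrite subn_gt0.
have pz i : ((p ^ (m - n) * i)%:R = 0 :> 'F_p)%R.
  by rewrite -(prednK mn) expnS -mulnA natrM pchar_Fp_0 // mul0r.
exists b1, b2, b3; apply: characteristic_generatorsI => //.
  (* Modulo [M] all p-th powers die, so the new generators give linear relations over F_p between
     the old ones. These have invertible coefficients, so G = [M], and Frattini's argument removes
     Phi(G). *)
  pose M := ('Phi(G) <*> (<[b1]> <*> <[b2]> <*> <[b3]>))%G.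
  have sMG : M \subset G by rewrite !join_subG !cycle_subG Phi_sub Gb1 Gb2 Gb3.
  have [Mb1 Mb2 Mb3] : [/\ b1 \in M, b2 \in M & b3 \in M].
    have: M \subset M by []. rewrite {1}/M !join_subG !cycle_subG.
    by case/and3P => _ /andP[].
  have sG'M : G^`(1) \subset M.
    by case: GT => pG _ _ _ _; rewrite (subset_trans _ (joing_subl _ _)) //
      (Phi_joing pG) joing_subl.
  have nM g : g \in G -> g \in 'N(M).
    exact: (subsetP (normal_norm (sub_der1_normal sG'M sMG))).
  have cQ g h : g \in G -> h \in G -> commute (coset M g) (coset M h).
    move=> Gg Gh; apply: (centsP (sub_der1_abelian sG'M)).
      by rewrite mem_quotient.
    by rewrite mem_quotient.
  have qp g : g \in G -> coset M g ^+ p = 1.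
    move=> Gg; rewrite -morphX ?nM //; apply: coset_id.
    by rewrite (subsetP (joing_subl _ _)) // expp_Phi.
  have qword (i j k : nat) : coset M (a1 ^+ i * a2 ^+ j * a3 ^+ k * 1) =
      coset M a1 ^+ i * coset M a2 ^+ j * coset M a3 ^+ k.
    by rewrite mulg1 !morphM ?morphX ?groupM ?groupX ?nM.
  have q3 : coset M a3 = 1.
    apply: (natr_Fp_neq0_id p_pr (i := t)); rewrite ?natr_Zp ?qp //.
    have := coset_id Mb3; rewrite qword -(prednK mn) expnS -!mulnA !expgM.
    by rewrite !qp // !expg1n !mul1g.
  have q1 := coset_id Mb1; have q2 := coset_id Mb2.
  rewrite /b1 /b2 !qword q3 !expg1n !mulg1 in q1 q2.
  have qa1 : coset M a1 = 1.
    by apply: abelian_solve2 q1 q2 D0; rewrite ?qp //; apply: cQ.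
  have qa2 : coset M a2 = 1.
    rewrite qa1 !expg1n !mul1g in q1 q2.
    apply: (abelian_solve2 p_pr (y := 1) (a := b) (b := a) (c := d) (d := c));
      rewrite ?expg1n ?mulg1 ?qp //; first exact: commute1.
    by rewrite -oppr_eq0 opprB.
  have sGM : G \subset M.
    apply/subsetP=> g Gg; apply: coset_idr; first exact: nM.
    have [i [j [k [e [eG' ->]]]]] := nw _ Gg.
    have Ge := subsetP (der_sub 1 G) _ eG'.
    rewrite morphM ?nM ?groupM ?groupX //=.
    rewrite (coset_id (subsetP sG'M _ eG')) -(mulg1 (_ * a3 ^+ k)) qword.
    by rewrite qa1 qa2 q3 !expg1n !mulg1.
  have : << <[b1]> <*> <[b2]> <*> <[b3]> >> = G.
    by apply: Phi_nongen; apply/eqP; rewrite eqEsubset sMG sGM.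
  by rewrite genGid => ->.
all: have Ex : [~ b2, b3] = comm_word (p := p) a1 a2 a3
         (t * d)%R (- (t * c))%R 0%R
       by rewrite commg_words // !pz !natr_Zp; congr comm_word; ring.
all: have Ey : [~ b3, b1] = comm_word (p := p) a1 a2 a3
         (- (t * b))%R (t * a)%R 0%R
       by rewrite commg_words // !pz !natr_Zp; congr comm_word; ring.
all: have Ez : [~ b1, b2] = comm_word (p := p) a1 a2 a3
         (b * v2 - v1 * d)%R (v1 * c - a * v2)%R (a * d - b * c)%R
       by rewrite commg_words // !natr_Zp.
all: rewrite (comm_word_change _ _ _ Ga1 Ga2 Ga3 Ex Ey Ez).
all: move: E; rewrite !mx3_mul !mul0r !addr0 => /mx3_inj[].
all: case=> E11 E12 E13 [E21 E22 E23] [E31 E32 E33].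
all: have [[F11 F12 F13] [F21 F22 F23] [F31 F32 F33]] :=
       mx3E v11 v12 v13 v21 v22 v23 v31 v32 v33.
all: rewrite ?F11 ?F12 ?F13 ?F21 ?F22 ?F23 ?F31 ?F32 ?F33 {F11 F12 F13 F21 F22 F23 F31 F32 F33}.
- by rewrite -E11 -E12 -E13 (power_word Ga1 Ga2 Ga3 A1 A2 A3) // !natr_Zp.
- by rewrite -E21 -E22 -E23 (power_word Ga1 Ga2 Ga3 A1 A2 A3) // !natr_Zp.
by rewrite -E31 -E32 -E33 (power_word3 Ga1 Ga2 Ga3 A1 A2 A3) // !natr_Zp.
Qed.

(** The elements generate G modulo G', which lies in Phi(G), so they generate G. *)
Lemma characteristic_generators_gen a1 a2 a3 (w : 'M['F_p]_3) :
  characteristic_generators m m n G a1 a2 a3 w ->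
  G :=: <[a1]> <*> <[a2]> <*> <[a3]>.
Proof.
move=> Ca; have nw := characteristic_generators_words Ca.
case: Ca => [[Ga1 Ga2 Ga3] _ _ _]; pose B := (<[a1]> <*> <[a2]> <*> <[a3]>)%G.
have [pG _ _ _ _] := GT.
have sBG : B \subset G by rewrite !join_subG !cycle_subG Ga1 Ga2 Ga3.
have [Ba1 Ba2 Ba3] : [/\ a1 \in B, a2 \in B & a3 \in B].
  have: B \subset B by []. rewrite {1}/B !join_subG !cycle_subG.
  by case/andP => /andP[].
rewrite -(genGid B); apply/esym/Phi_nongen/eqP.
rewrite eqEsubset join_subG Phi_sub sBG; apply/subsetP=> g /nw[i [j [k [c [cG' ->]]]]].
rewrite groupM //; first by rewrite (subsetP (joing_subr _ _)) // !groupM ?groupX.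
rewrite (subsetP (joing_subl _ _)) // (Phi_joing pG).
by rewrite (subsetP (joing_subl _ _)).
Qed.

End CharacteristicGenerators.

(** Thanks to [characteristic_generatorsI], only generation and the power relations have to be
    carried along the isomorphism; nothing is transported to the quotients by the derived
    subgroups. *)
Lemma characteristic_matrix_isog (p m n : nat) (gT hT : finGroupType)
    (G : {group gT}) (H : {group hT}) (w : 'M['F_p]_3) :
  prime p -> p_group_of_type p m m n G -> p_group_of_type p m m n H ->
  H \isog G ->
  characteristic_matrix m m n H w -> characteristic_matrix m m n G w.
Proof.
move=> p_pr GT HT /isogP[f injf fH] [a1 [a2 [a3 Ca]]].
have defH := characteristic_generators_gen p_pr HT Ca.
case: Ca => [[Ha1 Ha2 Ha3] _ _ [A1 A2 A3]].
have fm g : g \in H -> f g \in G by move=> Hg; rewrite -fH mem_morphim.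
have fK r s t : f (comm_word (p := p) a1 a2 a3 r s t) =
    comm_word (f a1) (f a2) (f a3) r s t.
  by rewrite /comm_word !morphM ?morphX ?morphR ?groupM ?groupX ?groupR ?groupV.
exists (f a1), (f a2), (f a3); apply: characteristic_generatorsI => //; rewrite ?fm //.
- have [sa1 sa2 sa3] : [/\ <[a1]> \subset H, <[a2]> \subset H & <[a3]> \subset H].
    by rewrite !cycle_subG.
  have sa12 : <[a1]> <*> <[a2]> \subset H by rewrite join_subG sa1.
  rewrite -fH (congr1 (fun B : {set hT} => f @* B) defH) !morphimY //.
  by rewrite !morphim_cycle.
- by rewrite -morphX // A1 fK.
- by rewrite -morphX // A2 fK.
- by rewrite -morphX // A3 fK.
Qed.

Local Open Scope ring_scope.

(** * Squares and binary quadratic forms over F_p *)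

Lemma val_oppFp (p : nat) (x : 'F_p) : prime p -> x != 0 -> (- x)%R = (p - x)%N :> nat.
Proof.
move=> p_pr x0; have x_gt0 : (0 < x)%N by rewrite lt0n; apply: contra x0 => /eqP x0; apply/eqP/val_inj.
have xp : (x <= p)%N by have := ltn_ord x; rewrite [X in (_ < X)%N]Fp_cast // => /ltnW.
rewrite -[x in LHS]natr_Zp -[LHS]/(val (- (x : nat)%:R : 'F_p)) .
have -> : (- (x : nat)%:R : 'F_p) = (p - x)%:R by rewrite natrB // pchar_Fp_0 // sub0r.
by rewrite /= val_Fp_nat // modn_small // ltn_subrL x_gt0 prime_gt0.
Qed.

Lemma two_neq0_Fp (p : nat) : prime p -> odd p -> (2%:R : 'F_p) != 0.
Proof.
move=> p_pr op; rewrite -(dvdn_pcharf (pchar_Fp p_pr)) dvdn_prime2 //.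
by apply: contraL op => /eqP ->.
Qed.

Definition squares (p : nat) : {set 'F_p} := [set x ^+ 2 | x : 'F_p].

(** A square determines its root up to sign, and for nonzero x exactly one of x, -x has its
    representative at most [p./2]. So [h] is injective, which gives the weak inequality; it is
    strict because p is odd. *)
Lemma card_squares (p : nat) : prime p -> odd p -> (p < 2 * #|squares p|)%N.
Proof.
move=> p_pr op.
pose h (x : 'F_p) := (x ^+ 2, (x <= p./2)%N).
have injh : injective h.
  move=> x y hxy; have /eqP h1 : x ^+ 2 = y ^+ 2 := congr1 fst hxy.
  have : (x <= p./2)%N = (y <= p./2)%N := congr1 snd hxy.
  move: h1; rewrite eqf_sqr => /orP[/eqP // | /eqP ->].
  have [-> | y0] := eqVneq y 0; first by rewrite oppr0.
  rewrite val_oppFp // => h2; exfalso; move: h2.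
  have key (i j : nat) : odd i -> (0 < j)%N -> (j < i)%N ->
      (i - j <= i./2)%N = (j <= i./2)%N -> False.
    by move=> oi; have := odd_double_half i; rewrite oi; lia.
  have := ltn_ord y; rewrite [X in (_ < X)%N]Fp_cast // => yp.
  have : (0 < y)%N by rewrite lt0n; apply: contra y0 => /eqP y0; apply/eqP/val_inj.
  by move=> y_gt0; apply: key.
have le : (p <= 2 * #|squares p|)%N.
  rewrite -{1}(card_Fp p_pr) -(card_imset predT injh) mulnC.
  have -> : (#|squares p| * 2 = #|setX (squares p) [set: bool]|)%N.
    by rewrite cardsX cardsT card_bool.
  apply: subset_leq_card; apply/subsetP => _ /imsetP[x _ ->].
  by rewrite inE in_setT andbT; apply/imsetP; exists x.
by rewrite ltn_neqAle le andbT; apply: contraL op => /eqP ->; rewrite oddM.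
Qed.

(** For odd p the set S of squares and its multiple by [eta] meet at most in 0, so their union has
    at least 2|S| - 1 elements, and this is at least p. For p = 2 the only unit is 1. *)
Lemma square_classes (p : nat) (eta k : 'F_p) :
  prime p -> (odd p -> ~ (exists x : 'F_p, x ^+ 2 = eta)) -> k != 0 ->
  exists nu z : 'F_p, [/\ in_1_eta eta nu, z != 0 & k = nu * z ^+ 2].
Proof.
move=> p_pr nsq k0; case: (boolP (odd p)) => [op | /negP op]; last first.
  have p2 : p = 2 by case: (even_prime p_pr).
  subst p; exists 1, 1; split; [by left | by rewrite oner_eq0 |].
  rewrite expr1n mulr1.
  by case: k k0 => [[|[|k]] ik] //= k0; apply: val_inj.
have eta0 : eta != 0.
  by apply/eqP => e0; apply: (nsq op); exists 0; rewrite e0 expr0n.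
pose S := squares p; pose T := [set eta * s | s in S].
have cT : #|T| = #|S| by apply: card_imset; apply: mulfI.
have ST : S :&: T \subset [set 0].
  apply/subsetP=> s; rewrite !inE => /andP[/imsetP[x _ ->]].
  case/imsetP => _ /imsetP[y _ ->] E.
  have [y0 | y0] := eqVneq y 0; first by rewrite E y0 expr0n mulr0.
  case: (nsq op); exists (x / y); rewrite expr_div_n E mulfK //.
  by rewrite expf_neq0.
have cU : (p <= #|S :|: T|)%N.
  have := cardsUI S T; have := subset_leq_card ST; have := card_squares p_pr op.
  by rewrite cards1 cT -/S; lia.
have : k \in S :|: T.
  suff -> : S :|: T = setT by rewrite inE.
  by apply/eqP; rewrite eqEcard subsetT cardsT card_Fp.
have nz z : z ^+ 2 != 0 :> 'F_p -> z != 0 by apply: contraNN => /eqP ->; rewrite expr0n.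
rewrite inE => /orP[/imsetP[z _ Ek] | /imsetP[_ /imsetP[z _ ->] Ek]].
  by exists 1, z; split; [left | apply: nz; rewrite -Ek | rewrite mul1r].
exists eta, z; split=> //; first by right.
by apply: nz; apply: contraNN k0 => /eqP z0; rewrite Ek z0 mulr0.
Qed.

(** Pigeonhole: the values of [a * x ^+ 2] and those of [1 - b * y ^+ 2] each fill more than half of
    F_p, so they meet. *)
Lemma binary_form_represents1 (p : nat) (a b : 'F_p) :
  prime p -> odd p -> a != 0 -> b != 0 ->
  exists x y : 'F_p, a * x ^+ 2 + b * y ^+ 2 = 1.
Proof.
move=> p_pr op a0 b0; pose S := squares p.
pose A := [set a * s | s in S]; pose B := [set 1 - b * s | s in S].
have cA : #|A| = #|S| by apply: card_imset; apply: mulfI.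
have cB : #|B| = #|S|.
  by apply: card_imset => x y /(addrI 1) /oppr_inj; apply: mulfI.
have : (0 < #|A :&: B|)%N.
  have le : (#|A :|: B| <= p)%N by rewrite -[leqRHS](card_Fp p_pr) max_card.
  by have := cardsUI A B; have := card_squares p_pr op; rewrite cA cB -/S; lia.
case/card_gt0P => u; rewrite inE => /andP[/imsetP[_ /imsetP[x _ ->] ->]].
case/imsetP => _ /imsetP[y _ ->] E; exists x, y.
by rewrite E subrK.
Qed.


(* The first index numbers the families that [block_class] tells apart; its
   value 7 covers one family for odd p and one matrix for p = 2. *)
Inductive reduced_block (p : nat) (eta : 'F_p) :
    nat -> 'F_p -> 'F_p -> 'F_p -> 'F_p -> Prop :=
| block_zero : reduced_block eta 0 0 0 0 0
| block_sym1 nu of in_1_eta eta nu : reduced_block eta 1 0 0 0 nu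
| block_nilp : reduced_block eta 2 0 0 1 0
| block_alt2 of p = 2%N : reduced_block eta 3 0 1 1 0
| block_sym2 nu of in_1_eta eta nu : reduced_block eta 4 1 0 0 nu
| block_alt of odd p : reduced_block eta 5 0 (- 1) 1 0
| block_alt_sym1 nu of odd p & in_1_eta eta nu :
    reduced_block eta 6 nu (- 1) 1 0
| block_alt_sym2 r of odd p & r != 0 & r != - 1 :
    reduced_block eta 7 1 (- 1) 1 r
| block_nonsym2 of p = 2%N : reduced_block eta 7 1 1 0 1.

(* The listed matrices, regrouped by the shape of the blocks b, c and e. *)
Inductive normal_form (p : nat) (eta : 'F_p) :
    'F_p -> 'F_p -> 'F_p -> 'F_p -> 'F_p -> 'F_p -> 'F_p -> 'F_p -> 'F_p ->
    Prop :=
| normal_e i a11 a12 a21 a22 of reduced_block eta i a11 a12 a21 a22 :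
    normal_form eta a11 a12 0 a21 a22 0 0 0 1
| normal_0 i a11 a12 a21 a22 of reduced_block eta i a11 a12 a21 a22
    & (i = 1%N -> a22 = 1) & (i = 6%N -> a11 = 1) :
    normal_form eta a11 a12 0 a21 a22 0 0 0 0
| normal_c0 : normal_form eta 0 0 0 0 0 0 1 0 0
| normal_c1 : normal_form eta 0 0 0 0 1 0 1 0 0
| normal_c2 : normal_form eta 0 0 0 1 0 0 0 1 0
| normal_b1 t : normal_form eta 1 0 0 0 0 1 0 t 0
| normal_b2 : normal_form eta 0 1 0 0 0 1 0 0 0
| normal_b3 : normal_form eta 0 1 0 0 0 1 1 0 0
| normal_b4 : normal_form eta 0 0 0 0 0 1 1 0 0
| normal_b5 t : normal_form eta 0 0 0 0 0 1 0 t 0.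

(** * The list of matrices against the normal forms *)

Lemma nat_parameter (p r : nat) : prime p -> odd p -> (1 <= r <= p - 2)%N ->
  (r%:R : 'F_p) != 0 /\ (r%:R : 'F_p) != - 1.
Proof.
move=> p_pr op /andP[r1 rp]; have p1 := prime_gt1 p_pr; split.
  by rewrite -(dvdn_pcharf (pchar_Fp p_pr)) gtnNdvd //; lia.
rewrite -addr_eq0 natr1 -(dvdn_pcharf (pchar_Fp p_pr)) gtnNdvd //; lia.
Qed.

(** The two excluded values are the degenerate ones: [block_alt_sym2] has determinant r + 1, and at
    r = 0 it would coincide with [block_alt_sym1] for nu = 1. *)
Lemma parameter_nat (p : nat) (r : 'F_p) : prime p -> r != 0 -> r != - 1 ->
  exists2 n, (1 <= n <= p - 2)%N & r = n%:R.
Proof.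
move=> p_pr r0 r1; exists (r : nat); last by rewrite natr_Zp.
have r_gt0 : (0 < r)%N by rewrite lt0n; apply: contra r0 => /eqP e0; apply/eqP/val_inj.
have := ltn_ord r; rewrite [X in (_ < X)%N]Fp_cast // => rp.
have : (r : nat) != p.-1.
  apply: contra r1 => /eqP e1; rewrite -(natr_Zp r) e1 -addr_eq0 natr1.
  by rewrite prednK ?prime_gt0 // pchar_Fp_0.
lia.
Qed.

Ltac mx3_entries :=
  apply/matrixP=> -[[|[|[|//]]] ?] -[[|[|[|//]]] ?];
  rewrite !mxE -?val_eqE /= ?inordK //= ?mulr0n ?mulr1n; ring.

(** Several list entries share a normal form: [H12] and [I6] are the values t = 0 missing from [G8]
    and [H15], while [G6] and [H6] are [block_sym2] for p = 2. *)
Lemma listed_normal_form (p : nat) (eta : 'F_p) (w : 'M['F_p]_3) :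
  prime p -> listed_matrix eta w ->
  exists w11 w12 w13 w21 w22 w23 w31 w32 w33,
    w = mx3 w11 w12 w13 w21 w22 w23 w31 w32 w33 /\
    normal_form eta w11 w12 w13 w21 w22 w23 w31 w32 w33.
Proof.
move=> p_pr L.
have fin w11 w12 w13 w21 w22 w23 w31 w32 w33 :
  w = mx3 w11 w12 w13 w21 w22 w23 w31 w32 w33 ->
  normal_form eta w11 w12 w13 w21 w22 w23 w31 w32 w33 ->
  exists w11 w12 w13 w21 w22 w23 w31 w32 w33,
    w = mx3 w11 w12 w13 w21 w22 w23 w31 w32 w33 /\
    normal_form eta w11 w12 w13 w21 w22 w23 w31 w32 w33.
  by move=> *; do 9!eexists; split; eassumption.
have one : in_1_eta eta 1 by left.
case: {w}L fin.
- by move=> op fin; apply: (fin _ _ _ _ _ _ _ _ _ _ (normal_e (block_alt eta op))); mx3_entries.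
- by move=> nu op hnu fin; apply: (fin _ _ _ _ _ _ _ _ _ _ (normal_e (block_alt_sym1 op hnu))); mx3_entries.
- by move=> nu op hnu fin; apply: (fin _ _ _ _ _ _ _ _ _ _ (normal_e (block_sym2 hnu))); mx3_entries.
- by move=> r op /(nat_parameter p_pr op)[r0 r1] fin; apply: (fin _ _ _ _ _ _ _ _ _ _ (normal_e (block_alt_sym2 eta op r0 r1))); mx3_entries.
- by move=> op fin; apply: (fin _ _ _ _ _ _ _ _ _ _ (normal_0 (block_alt eta op) _ _)); [mx3_entries | ..].
- by move=> op fin; apply: (fin _ _ _ _ _ _ _ _ _ _ (normal_0 (block_alt_sym1 op one) _ _)); [mx3_entries | ..].
- by move=> nu op hnu fin; apply: (fin _ _ _ _ _ _ _ _ _ _ (normal_0 (block_sym2 hnu) _ _)); [mx3_entries | ..].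
- by move=> r op /(nat_parameter p_pr op)[r0 r1] fin; apply: (fin _ _ _ _ _ _ _ _ _ _ (normal_0 (block_alt_sym2 eta op r0 r1) _ _)); [mx3_entries | ..].
- by move=> p2 fin; apply: (fin _ _ _ _ _ _ _ _ _ _ (normal_e (block_alt2 eta p2))); mx3_entries.
- by move=> p2 fin; apply: (fin _ _ _ _ _ _ _ _ _ _ (normal_e (block_sym2 one))); mx3_entries.
- by move=> p2 fin; apply: (fin _ _ _ _ _ _ _ _ _ _ (normal_e (block_nonsym2 eta p2))); mx3_entries.
- by move=> p2 fin; apply: (fin _ _ _ _ _ _ _ _ _ _ (normal_0 (block_alt2 eta p2) _ _)); [mx3_entries | ..].
- by move=> p2 fin; apply: (fin _ _ _ _ _ _ _ _ _ _ (normal_0 (block_sym2 one) _ _)); [mx3_entries | ..].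
- by move=> p2 fin; apply: (fin _ _ _ _ _ _ _ _ _ _ (normal_0 (block_nonsym2 eta p2) _ _)); [mx3_entries | ..].
- by move=> t t0 fin; apply: (fin _ _ _ _ _ _ _ _ _ _ (normal_b1 eta t)); mx3_entries.
- by move=>  fin; apply: (fin _ _ _ _ _ _ _ _ _ _ (normal_b3 eta)); mx3_entries.
- by move=>  fin; apply: (fin _ _ _ _ _ _ _ _ _ _ (normal_e (block_nilp eta))); mx3_entries.
- by move=> nu hnu fin; apply: (fin _ _ _ _ _ _ _ _ _ _ (normal_e (block_sym1 hnu))); mx3_entries.
- by move=>  fin; apply: (fin _ _ _ _ _ _ _ _ _ _ (normal_c2 eta)); mx3_entries.
- by move=>  fin; apply: (fin _ _ _ _ _ _ _ _ _ _ (normal_c1 eta)); mx3_entries.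
- by move=>  fin; apply: (fin _ _ _ _ _ _ _ _ _ _ (normal_b1 eta 0)); mx3_entries.
- by move=>  fin; apply: (fin _ _ _ _ _ _ _ _ _ _ (normal_b2 eta)); mx3_entries.
- by move=>  fin; apply: (fin _ _ _ _ _ _ _ _ _ _ (normal_b4 eta)); mx3_entries.
- by move=> t t0 fin; apply: (fin _ _ _ _ _ _ _ _ _ _ (normal_b5 eta t)); mx3_entries.
- by move=>  fin; apply: (fin _ _ _ _ _ _ _ _ _ _ (normal_e (block_zero eta))); mx3_entries.
- by move=>  fin; apply: (fin _ _ _ _ _ _ _ _ _ _ (normal_0 (block_nilp eta) _ _)); [mx3_entries | ..].
- by move=>  fin; apply: (fin _ _ _ _ _ _ _ _ _ _ (normal_0 (block_sym1 one) _ _)); [mx3_entries | ..].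
- by move=>  fin; apply: (fin _ _ _ _ _ _ _ _ _ _ (normal_c0 eta)); mx3_entries.
- by move=>  fin; apply: (fin _ _ _ _ _ _ _ _ _ _ (normal_0 (block_zero eta) _ _)); [mx3_entries | ..].
- by move=>  fin; apply: (fin _ _ _ _ _ _ _ _ _ _ (normal_b5 eta 0)); mx3_entries.
Qed.

Lemma normal_form_listed (p : nat) (eta w11 w12 w13 w21 w22 w23 w31 w32 w33 : 'F_p) :
  prime p -> normal_form eta w11 w12 w13 w21 w22 w23 w31 w32 w33 ->
  listed_matrix eta (mx3 w11 w12 w13 w21 w22 w23 w31 w32 w33).
Proof.
move=> p_pr; have fin w w' : listed_matrix eta w -> w' = w -> listed_matrix eta w'.
  by move=> lw ->.
have nu2 nu : ~~ odd p -> in_1_eta eta nu -> nu = 1 by move=> /negP op [|[]].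
have p2 : ~~ odd p -> p = 2%N by case: (even_prime p_pr) => [|->].
case=> {w11 w12 w13 w21 w22 w23 w31 w32 w33}.
- move=> i a11 a12 a21 a22; case=> {i a11 a12 a21 a22}.
  + by apply: (fin _ _ (I1 eta)); mx3_entries.
  + by move=> nu hnu; apply: (fin _ _ (H9 hnu)); mx3_entries.
  + by apply: (fin _ _ (H8 eta)); mx3_entries.
  + by move=> q; apply: (fin _ _ (G5 eta q)); mx3_entries.
  + move=> nu hnu; case: (boolP (odd p)) => op.
      by apply: (fin _ _ (G3 op hnu)); mx3_entries.
    by rewrite (nu2 _ op hnu); apply: (fin _ _ (G6 eta (p2 op))); mx3_entries.
  + by move=> op; apply: (fin _ _ (G1 eta op)); mx3_entries.
  + by move=> nu op hnu; apply: (fin _ _ (G2 op hnu)); mx3_entries.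
  + move=> r op r0 r1; have [k hk ->] := parameter_nat p_pr r0 r1.
    by apply: (fin _ _ (G4 eta op hk)); mx3_entries.
  + by move=> q; apply: (fin _ _ (G7 eta q)); mx3_entries.
- move=> i a11 a12 a21 a22; case=> {i a11 a12 a21 a22}.
  + by move=> _ _; apply: (fin _ _ (I5 eta)); mx3_entries.
  + by move=> nu _ /(_ erefl)-> _; apply: (fin _ _ (I3 eta)); mx3_entries.
  + by move=> _ _; apply: (fin _ _ (I2 eta)); mx3_entries.
  + by move=> q _ _; apply: (fin _ _ (H5 eta q)); mx3_entries.
  + move=> nu hnu _ _; case: (boolP (odd p)) => op.
      by apply: (fin _ _ (H3 op hnu)); mx3_entries.
    by rewrite (nu2 _ op hnu); apply: (fin _ _ (H6 eta (p2 op))); mx3_entries.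
  + by move=> op _ _; apply: (fin _ _ (H1 eta op)); mx3_entries.
  + by move=> nu op _ _ /(_ erefl)->; apply: (fin _ _ (H2 eta op)); mx3_entries.
  + move=> r op r0 r1 _ _; have [k hk ->] := parameter_nat p_pr r0 r1.
    by apply: (fin _ _ (H4 eta op hk)); mx3_entries.
  + by move=> q _ _; apply: (fin _ _ (H7 eta q)); mx3_entries.
- by apply: (fin _ _ (I4 eta)); mx3_entries.
- by apply: (fin _ _ (H11 eta)); mx3_entries.
- by apply: (fin _ _ (H10 eta)); mx3_entries.
- move=> t; have [-> | t0] := eqVneq t 0.
    by apply: (fin _ _ (H12 eta)); mx3_entries.
  by apply: (fin _ _ (G8 eta t0)); mx3_entries.
- by apply: (fin _ _ (H13 eta)); mx3_entries.
- by apply: (fin _ _ (G9 eta)); mx3_entries.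
- by apply: (fin _ _ (H14 eta)); mx3_entries.
move=> t; have [-> | t0] := eqVneq t 0.
  by apply: (fin _ _ (I6 eta)); mx3_entries.
by apply: (fin _ _ (H15 eta t0)); mx3_entries.
Qed.

Lemma F2_neq0 (p : nat) (x : 'F_p) : p = 2%N -> x != 0 -> x = 1.
Proof.
by move=> p2; subst p; case: x => [[|[|k]] ik] //= k0; apply: val_inj.
Qed.

(** * Bilinear forms in two variables up to congruence and scaling *)

Section BlockReduction.

Variables (p : nat) (R : 'F_p -> 'F_p -> 'F_p -> 'F_p -> Prop).
Hypothesis p_pr : prime p.
Hypothesis R_congruence : forall a b c d w11 w12 w21 w22 x11 x12 x21 x22 : 'F_p,
  let D := a * d - b * c in let T := D * D in D != 0 ->
  x11 * T = a * (w11 * a + w12 * b) + b * (w21 * a + w22 * b) ->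
  x12 * T = a * (w11 * c + w12 * d) + b * (w21 * c + w22 * d) ->
  x21 * T = c * (w11 * a + w12 * b) + d * (w21 * a + w22 * b) ->
  x22 * T = c * (w11 * c + w12 * d) + d * (w21 * c + w22 * d) ->
  R w11 w12 w21 w22 -> R x11 x12 x21 x22.

(** The hypothesis on [R] allows only the scaling with t = D, which is available for e = 1 and for e
    = 0 alike. The reduction stops where the two cases begin to differ. *)
Lemma block_reduction w11 w12 w21 w22 : R w11 w12 w21 w22 ->
  [\/ R 0 0 0 0 \/ R 0 (- 1) 1 0,
      (exists2 k, k != 0 & R 0 0 0 k) \/ R 0 0 1 0,
      odd p /\ (exists a k b, [/\ a != 0, a * b + k * k != 0 & R a (- k) k b])
    | p = 2%N /\ (R 1 0 0 1 \/ R 1 1 0 1)].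
Proof.
move=> Rw; have [altw | naltw] := boolP [&& w11 == 0, w22 == 0 & w12 + w21 == 0].
  case/and3P: altw => /eqP E1 /eqP E2; rewrite addr_eq0 => /eqP E3; constructor 1.
  rewrite E1 E2 E3 in Rw; have [k0 | k0] := eqVneq w21 0.
    by left; rewrite k0 oppr0 in Rw.
  by right; apply: (R_congruence (a := w21) (b := 0) (c := 0) (d := 1) _ _ _ _ _ Rw);
    rewrite ?mulr1 ?mulr0 ?mul0r ?subr0 //; ring.
(* A form that is not alternating is nonzero on the diagonal at one of the vectors (1, 0), (0, 1),
   (1, 1); that vector becomes the first basis vector. *)
have {w11 w12 w21 w22 Rw naltw} [a [x [y [z [a0 Rw]]]]] : exists a x y z, a != 0 /\ R a x y z.
  have [E1 | E1] := eqVneq w11 0; last by exists w11, w12, w21, w22.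
  have [E2 | E2] := eqVneq w22 0; last first.
    exists w22, w21, w12, w11; split=> //.
    by apply: (R_congruence (a := 0) (b := 1) (c := 1) (d := 0) _ _ _ _ _ Rw);
      rewrite ?mulr1 ?mulr0 ?sub0r ?oppr_eq0 ?oner_neq0 //; ring.
  rewrite E1 E2 !eqxx /= in naltw.
  exists (w12 + w21), w12, w21, 0; split=> //.
  by apply: (R_congruence (a := 1) (b := 1) (c := 0) (d := 1) _ _ _ _ _ Rw);
    rewrite ?mulr1 ?mulr0 ?mul0r ?subr0 ?oner_neq0 // ?E1 ?E2; ring.
(* A singular block is the column (a, y) times the row (a, x), divided by [a]. Its left and right
   kernels are spanned by (-y, a) and (-x, a). If they coincide, the kernel and (1, 0) give a
   diagonal form; otherwise the two kernels form a basis and only the lower left entry survives. *)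
have [det0 | det0] := eqVneq (a * z - x * y) 0.
  have zE : z = x * y / a.
    have <- : a * z = x * y by apply/eqP; rewrite -subr_eq0 det0.
    by field.
  constructor 2; have [xy | xy] := eqVneq x y.
    left; exists a => //.
    apply: (R_congruence (a := - y / a) (b := 1) (c := 1) (d := 0) _ _ _ _ _ Rw);
      rewrite ?mulr1 ?mulr0 ?sub0r ?oppr_eq0 ?oner_neq0 ?zE ?xy //; by field.
  right; have yx : y - x != 0 by rewrite subr_eq0 eq_sym.
  apply: (R_congruence (a := - y) (b := a) (c := x / a) (d := - 1) _ _ _ _ _ Rw);
    rewrite ?zE; try by field.
  by have -> : - y * - 1 - a * (x / a) = y - x by field.
have [op | op] := boolP (odd p).
  have two0 := two_neq0_Fp p_pr op.
  (* Completing the square: [g] makes the symmetric part diagonal and, as D = 1, leaves the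
     alternating part (y - x) / 2 unchanged. The quantity [a * b + k * k] is the determinant of the
     block. *)
  constructor 3; split=> //; pose g := - (x + y) / (2%:R * a).
  exists a, ((y - x) / 2%:R), (z + g * (x + y) + g * g * a); split=> //.
    suff -> : a * (z + g * (x + y) + g * g * a) +
      (y - x) / 2%:R * ((y - x) / 2%:R) = a * z - x * y by [].
    by rewrite /g; field; rewrite ?a0 ?two0 //.
  apply: (R_congruence (a := 1) (b := 0) (c := g) (d := 1) _ _ _ _ _ Rw);
    rewrite ?mulr1 ?mulr0 ?mul0r ?subr0 ?oner_neq0 // /g; field; rewrite ?a0 ?two0 //.
have p2 : p = 2%N by case: (even_prime p_pr) => // op'; rewrite op' in op.
constructor 4; split=> //; have a1 := F2_neq0 p2 a0; rewrite {}a1 in det0 Rw.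
have z1 : z - x * y = 1 by apply: F2_neq0 => //; rewrite mul1r in det0.
have zE : z = 1 + x * y by rewrite -z1 subrK.
have {}Rw : R 1 (x - y) 0 1.
  rewrite zE in Rw; apply: (R_congruence (a := 1) (b := 0) (c := - y) (d := 1) _ _ _ _ _ Rw);
    rewrite ?mulr1 ?mulr0 ?mul0r ?subr0 ?oner_neq0 //; ring.
have [xy | xy] := eqVneq (x - y) 0; first by left; rewrite xy in Rw.
by right; rewrite (F2_neq0 p2 xy) in Rw.
Qed.

End BlockReduction.

(** * Reduction to normal form inside a predicate closed under changes of generators *)

Section Reduction.

Variables (p : nat) (eta : 'F_p) (Q : 'M['F_p]_3 -> Prop).
Hypotheses (p_pr : prime p)
  (nsq : odd p -> ~ (exists x : 'F_p, x ^+ 2 = eta)).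
Hypothesis Q_base_change : forall w w', Q w -> base_change w w' -> Q w'.

Local Notation W := (mx3 (p := p)).

(** The action with its denominators cleared, so that a caller supplies the target entries and is
    left with polynomial identities. The cofactor matrix times the transposed matrix of exponents is
    the scalar [T]; the local fact [row] inverts this one row at a time. *)
Lemma base_change_move (a b c d u1 u2 v1 v2 t : 'F_p)
    (w11 w12 w13 w21 w22 w23 w31 w32 w33
     x11 x12 x13 x21 x22 x23 x31 x32 x33 : 'F_p) :
  let D := a * d - b * c in let T := t * D in
  D != 0 -> t != 0 ->
  let M1 x y z := x * a + y * b + z * v1 in
  let M2 x y z := x * c + y * d + z * v2 in
  x11 * T = a * M1 w11 w12 w13 + b * M1 w21 w22 w23 ->
  x12 * T = a * M2 w11 w12 w13 + b * M2 w21 w22 w23 ->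
  x13 * D = a * w13 + b * w23 ->
  x21 * T = c * M1 w11 w12 w13 + d * M1 w21 w22 w23 ->
  x22 * T = c * M2 w11 w12 w13 + d * M2 w21 w22 w23 ->
  x23 * D = c * w13 + d * w23 ->
  x31 * T = u1 * M1 w11 w12 w13 + u2 * M1 w21 w22 w23 + t * M1 w31 w32 w33 ->
  x32 * T = u1 * M2 w11 w12 w13 + u2 * M2 w21 w22 w23 + t * M2 w31 w32 w33 ->
  x33 * D = u1 * w13 + u2 * w23 + t * w33 ->
  Q (W w11 w12 w13 w21 w22 w23 w31 w32 w33) ->
  Q (W x11 x12 x13 x21 x22 x23 x31 x32 x33).
Proof.
move=> D T D0 t0 M1 M2 E11 E12 E13 E21 E22 E23 E31 E32 E33 Qw.
apply: (Q_base_change Qw); exists a, b, c, d, u1, u2, v1, v2, t; split=> //.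
have row r1 r2 r3 y1 y2 y3 : y1 * T = M1 r1 r2 r3 -> y2 * T = M2 r1 r2 r3 ->
    y3 * D = r3 ->
    [/\ r1 = y1 * (t * d) + y2 * - (t * b) + y3 * (b * v2 - v1 * d),
        r2 = y1 * - (t * c) + y2 * (t * a) + y3 * (v1 * c - a * v2)
      & r3 = y1 * 0 + y2 * 0 + y3 * (a * d - b * c)].
  move=> E1 E2 E3; split; last by rewrite -E3 /D; ring.
    apply: (mulIf D0); transitivity (d * (y1 * T) - b * (y2 * T) +
      (b * v2 - v1 * d) * (y3 * D)); last by rewrite /T /D; ring.
    by rewrite E1 E2 E3 /M1 /M2 /D; ring.
  apply: (mulIf D0); transitivity (a * (y2 * T) - c * (y1 * T) +
    (v1 * c - a * v2) * (y3 * D)); last by rewrite /T /D; ring.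
  by rewrite E1 E2 E3 /M1 /M2 /D; ring.
rewrite !mx3_mul !mul0r !addr0.
have [|||-> -> ->] := row (a * w11 + b * w21) (a * w12 + b * w22)
  (a * w13 + b * w23) x11 x12 x13; rewrite ?E11 ?E12 ?E13 /M1 /M2; try ring.
have [|||-> -> ->] := row (c * w11 + d * w21) (c * w12 + d * w22)
  (c * w13 + d * w23) x21 x22 x23; rewrite ?E21 ?E22 ?E23 /M1 /M2; try ring.
have [|||-> -> ->] := row (u1 * w11 + u2 * w21 + t * w31)
  (u1 * w12 + u2 * w22 + t * w32) (u1 * w13 + u2 * w23 + t * w33) x31 x32 x33;
  rewrite ?E31 ?E32 ?E33 /M1 /M2; try ring.
by rewrite !mulr0 !addr0 !add0r.
Qed.

Lemma normal_form_b (w11 w12 w21 w22 w31 w32 w13 w23 w33 : 'F_p) :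
  (w13 != 0) || (w23 != 0) -> Q (W w11 w12 w13 w21 w22 w23 w31 w32 w33) ->
  exists x11 x12 x13 x21 x22 x23 x31 x32 x33,
    normal_form eta x11 x12 x13 x21 x22 x23 x31 x32 x33 /\
    Q (W x11 x12 x13 x21 x22 x23 x31 x32 x33).
Proof.
move=> b0 Qw.
have fin x11 x12 x13 x21 x22 x23 x31 x32 x33 :
  normal_form eta x11 x12 x13 x21 x22 x23 x31 x32 x33 ->
  Q (W x11 x12 x13 x21 x22 x23 x31 x32 x33) ->
  exists x11 x12 x13 x21 x22 x23 x31 x32 x33,
    normal_form eta x11 x12 x13 x21 x22 x23 x31 x32 x33 /\
    Q (W x11 x12 x13 x21 x22 x23 x31 x32 x33).
  by move=> *; do 9!eexists; split; eassumption.
have {w11 w12 w21 w22 w31 w32 w13 w23 w33 b0 Qw} [a1 [a2 [a3 [a4 [c1 [c2 Qw]]]]]] :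
    exists a1 a2 a3 a4 c1 c2, Q (W a1 a2 0 a3 a4 1 c1 c2 0).
  (* The first row of P is orthogonal to b, and (r, s) completes it to an invertible matrix; then P
     b = (0, D), so b' = e_2. The numbers u1, u2 solve u b + e = 0. *)
  have [r [s D0]] : exists r s, w23 * s - - w13 * r != 0.
    case/orP: b0 => b0; [exists 1, 0 | exists 0, 1].
      by rewrite mulr0 mulr1 sub0r opprK.
    by rewrite mulr0 mulr1 subr0.
  have [u1 [u2 E]] : exists u1 u2, u1 * w13 + u2 * w23 + w33 = 0.
    case/orP: b0 => b0; [exists (- w33 / w13), 0 | exists 0, (- w33 / w23)].
      by field.
    by field.
  pose T := 1 * (w23 * s - - w13 * r).
  have T0 : T != 0 by rewrite /T mul1r.
  do 6!eexists; apply: (base_change_move (a := w23) (b := - w13) (c := r) (d := s)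
    (u1 := u1) (u2 := u2) (v1 := 0) (v2 := 0) (t := 1) D0 (oner_neq0 _) _ _ _ _ _ _ _ _ _ Qw).
  - exact: (divfK T0).
  - exact: (divfK T0).
  - by ring.
  - exact: (divfK T0).
  - exact: (divfK T0).
  - by ring.
  - exact: (divfK T0).
  - exact: (divfK T0).
  - by rewrite mul1r E mul0r.
have {a3 a4 Qw} Qw : Q (W a1 a2 0 0 0 1 c1 c2 0).
  apply: (base_change_move (a := 1) (b := 0) (c := 0) (d := 1) (u1 := 0) (u2 := 0)
    (v1 := - a3) (v2 := - a4) (t := 1) _ _ _ _ _ _ _ _ _ _ _ Qw); rewrite ?oner_neq0 //;
    try ring.
  by rewrite !mulr1 mulr0 subr0 oner_neq0.
(* These moves keep b = e_2, e = 0 and the second row of A zero; v1 and v2 are the values that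
   restore that zero row. *)
have mv u g s t (x1 x2 y1 y2 : 'F_p) : s != 0 -> t != 0 ->
    x1 * (t * s) = a1 -> x2 * (t * s) = a1 * g + a2 * s ->
    y1 * (t * s) = u * a1 + t * c1 ->
    y2 * (t * s) = u * (a1 * g + a2 * s) + t * (c1 * g + c2 * s) ->
    Q (W x1 x2 0 0 0 1 y1 y2 0).
  move=> s0 t0 E1 E2 E3 E4.
  apply: (base_change_move (a := 1) (b := 0) (c := g) (d := s) (u1 := u) (u2 := 0)
    (v1 := - g * a1 / s) (v2 := - g * (a1 * g + a2 * s) / s) (t := t) _ _ _ _ _ _ _ _ _ _ _ Qw);
    rewrite ?mul1r ?mul0r ?subr0 ?E1 ?E2 ?E3 ?E4 //; try ring.
    by field.
  by field.
have [a10 | a10] := eqVneq a1 0; last first.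
  apply: (fin _ _ _ _ _ _ _ _ _ (normal_b1 eta (c2 - c1 * a2 / a1))).
  by apply: (mv (- c1) (- a2 / a1) 1 a1); rewrite ?oner_neq0 //; field.
have [a20 | a20] := eqVneq a2 0; last first.
  have [c10 | c10] := eqVneq c1 0.
    apply: (fin _ _ _ _ _ _ _ _ _ (normal_b2 eta)).
    by apply: (mv (- c2) 0 1 a2); rewrite ?oner_neq0 // ?a10 ?c10; ring.
  apply: (fin _ _ _ _ _ _ _ _ _ (normal_b3 eta)).
  by apply: (mv (- c2) 0 c1 a2); rewrite ?oner_neq0 // ?a10; ring.
have [c10 | c10] := eqVneq c1 0.
  apply: (fin _ _ _ _ _ _ _ _ _ (normal_b5 eta c2)).
  by rewrite a10 a20 c10 in Qw.
apply: (fin _ _ _ _ _ _ _ _ _ (normal_b4 eta)).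
by apply: (mv 0 (- c2) c1 1); rewrite ?oner_neq0 // ?a10 ?a20; ring.
Qed.

Lemma normal_form_e (w11 w12 w21 w22 w31 w32 w33 : 'F_p) :
  w33 != 0 -> Q (W w11 w12 0 w21 w22 0 w31 w32 w33) ->
  exists i x11 x12 x21 x22, reduced_block eta i x11 x12 x21 x22 /\
    Q (W x11 x12 0 x21 x22 0 0 0 1).
Proof.
move=> e0 Qw; pose R x11 x12 x21 x22 := Q (W x11 x12 0 x21 x22 0 0 0 1).
(* Taking t = D keeps the corner entry equal to 1. *)
have RC (a b c d y11 y12 y21 y22 x11 x12 x21 x22 : 'F_p) :
    let D := a * d - b * c in let T := D * D in D != 0 ->
    x11 * T = a * (y11 * a + y12 * b) + b * (y21 * a + y22 * b) ->
    x12 * T = a * (y11 * c + y12 * d) + b * (y21 * c + y22 * d) ->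
    x21 * T = c * (y11 * a + y12 * b) + d * (y21 * a + y22 * b) ->
    x22 * T = c * (y11 * c + y12 * d) + d * (y21 * c + y22 * d) ->
    R y11 y12 y21 y22 -> R x11 x12 x21 x22.
  move=> D T D0 E11 E12 E21 E22.
  apply: (base_change_move (a := a) (b := b) (c := c) (d := d)
    (u1 := 0) (u2 := 0) (v1 := 0) (v2 := 0) (t := D)) => //;
    rewrite -/D -/T ?E11 ?E12 ?E21 ?E22; ring.
have [x11 [x12 [x21 [x22 Rx]]]] : exists x11 x12 x21 x22, R x11 x12 x21 x22.
  (* With P = diag(w33, 1) and t = 1 the corner entry becomes w33 / D = 1, while v clears the corner
     row without touching A, because b = 0. *)
  have D0 : w33 * 1 - 0 * 0 != 0 by rewrite mulr1 mulr0 subr0.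
  have T0 : 1 * (w33 * 1 - 0 * 0) != 0 by rewrite mul1r.
  do 4!eexists; apply: (base_change_move (a := w33) (b := 0) (c := 0)
    (d := 1) (u1 := 0) (u2 := 0) (v1 := - w31) (v2 := - w32 / w33) (t := 1)
    D0 (oner_neq0 _) _ _ _ _ _ _ _ _ _ Qw).
  - exact: (divfK T0).
  - exact: (divfK T0).
  - by ring.
  - exact: (divfK T0).
  - exact: (divfK T0).
  - by ring.
  - by ring.
  - by field.
  by ring.
have fin i y11 y12 y21 y22 : reduced_block eta i y11 y12 y21 y22 -> R y11 y12 y21 y22 ->
    exists i x11 x12 x21 x22, reduced_block eta i x11 x12 x21 x22 /\
      Q (W x11 x12 0 x21 x22 0 0 0 1).
  by move=> By Ry; exists i, y11, y12, y21, y22.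
have one : in_1_eta eta 1 by left.
case: (block_reduction p_pr RC Rx) => [[R0 | RJ] | [[k k0 Rk] | Rn] | [op H] | [p2 [R1 | R1]]].
- exact: fin (block_zero eta) R0.
- have [op | op] := boolP (odd p); first exact: fin (block_alt eta op) RJ.
  have p2 : p = 2%N by case: (even_prime p_pr) => // op'; rewrite op' in op.
  apply: fin (block_alt2 eta p2) _.
  by rewrite -[X in R _ X](F2_neq0 p2 (x := - 1)) ?oppr_eq0 ?oner_neq0.
- have [nu [z [hnu z0 kE]]] := square_classes p_pr nsq k0.
  apply: (fin _ _ _ _ _ (block_sym1 hnu)).
  apply: (RC z 0 0 1 _ _ _ _ _ _ _ _ _ _ _ _ _ Rk); rewrite ?kE ?mulr1 ?mulr0 ?subr0 //;
    ring.
- exact: fin (block_nilp eta) Rn.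
- case: H => a [k [b [a0 det0 Rk]]]; have [k0 | k0] := eqVneq k 0.
    have {det0} b0 : b != 0.
      by apply: contraNneq det0 => ->; rewrite k0 !mulr0 addr0.
    (* The vector (- b y, a x) is orthogonal to (x, y) for the symmetric part, and the determinant
       of the pair is the represented value 1. So diag(a, b) becomes diag(1, a b), and an
       alternating part is left alone; the case k != 0 uses the same basis. *)
    have [x [y xy]] := binary_form_represents1 p_pr op a0 b0.
    have ab0 : a * b != 0 by rewrite mulf_neq0.
    have [nu [z [hnu z0 abE]]] := square_classes p_pr nsq ab0.
    apply: (fin _ _ _ _ _ (block_sym2 hnu)).
    have {Rk} R1 : R 1 0 0 (a * b).
      have D1 : x * (a * x) - y * - (b * y) = 1 by rewrite -xy; ring.
      apply: (RC x y (- (b * y)) (a * x) _ _ _ _ _ _ _ _ _ _ _ _ _ Rk);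
        rewrite ?D1 ?oner_neq0 ?k0 //; try ring.
        by rewrite -{1}xy; ring.
      by transitivity (a * b * (a * x ^+ 2 + b * y ^+ 2)); [rewrite xy; ring | ring].
    apply: (RC z 0 0 1 _ _ _ _ _ _ _ _ _ _ _ _ _ R1); rewrite ?abE ?mulr1 ?mulr0 ?subr0 //;
      ring.
  have {det0 Rk a0} [s [b0 [s0 det0 Rk]]] :
      exists s b, [/\ s != 0, s * b != - 1 & R s (- 1) 1 b].
    exists (a / (k * k)), b; split; first by rewrite mulf_neq0 ?invr_eq0 ?mulf_neq0.
      apply: contraNneq det0 => sb.
      have -> : a * b + k * k = (a / (k * k) * b + 1) * (k * k) by field.
      by rewrite sb addNr mul0r.
    by apply: (RC 1 0 0 k _ _ _ _ _ _ _ _ _ _ _ _ _ Rk); rewrite ?mul1r ?mulr0 ?subr0 //;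
      field.
  have [bz | b1] := eqVneq b0 0.
    have [nu [z [hnu z0 sE]]] := square_classes p_pr nsq s0.
    apply: (fin _ _ _ _ _ (block_alt_sym1 op hnu)).
    apply: (RC (1 / z) 0 0 z _ _ _ _ _ _ _ _ _ _ _ _ _ Rk); rewrite ?bz ?sE;
      try (by field).
    by rewrite mulr0 subr0 divfK // oner_neq0.
  have [x [y xy]] := binary_form_represents1 p_pr op s0 b1.
  apply: (fin _ _ _ _ _ (block_alt_sym2 eta op (mulf_neq0 s0 b1) det0)).
  have D1 : x * (s * x) - y * - (b0 * y) = 1 by rewrite -xy; ring.
  apply: (RC x y (- (b0 * y)) (s * x) _ _ _ _ _ _ _ _ _ _ _ _ _ Rk);
    rewrite ?D1 ?oner_neq0 //.
  - by rewrite -{1}xy; ring.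
  - by transitivity (- (s * x ^+ 2 + b0 * y ^+ 2)); [rewrite xy; ring | ring].
  - by transitivity (s * x ^+ 2 + b0 * y ^+ 2); [rewrite xy; ring | ring].
  by transitivity (s * b0 * (s * x ^+ 2 + b0 * y ^+ 2)); [rewrite xy; ring | ring].
- exact: fin (block_sym2 one) R1.
exact: fin (block_nonsym2 eta p2) R1.
Qed.

Lemma normal_form_0 (w11 w12 w21 w22 w31 w32 : 'F_p) :
  Q (W w11 w12 0 w21 w22 0 w31 w32 0) ->
  exists x11 x12 x13 x21 x22 x23 x31 x32 x33,
    normal_form eta x11 x12 x13 x21 x22 x23 x31 x32 x33 /\
    Q (W x11 x12 x13 x21 x22 x23 x31 x32 x33).
Proof.
move=> Qw.
have fin x11 x12 x13 x21 x22 x23 x31 x32 x33 :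
  normal_form eta x11 x12 x13 x21 x22 x23 x31 x32 x33 ->
  Q (W x11 x12 x13 x21 x22 x23 x31 x32 x33) ->
  exists x11 x12 x13 x21 x22 x23 x31 x32 x33,
    normal_form eta x11 x12 x13 x21 x22 x23 x31 x32 x33 /\
    Q (W x11 x12 x13 x21 x22 x23 x31 x32 x33).
  by move=> *; do 9!eexists; split; eassumption.
(* The corner row is hidden while A is being reduced and is examined again for each reduced
   block. *)
pose R x11 x12 x21 x22 := exists c1 c2, Q (W x11 x12 0 x21 x22 0 c1 c2 0).
have mv (a b c d t u1 u2 y11 y12 y21 y22 y31 y32 x11 x12 x21 x22 x31 x32 : 'F_p) :
    let D := a * d - b * c in let T := t * D in D != 0 -> t != 0 ->
    x11 * T = a * (y11 * a + y12 * b) + b * (y21 * a + y22 * b) ->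
    x12 * T = a * (y11 * c + y12 * d) + b * (y21 * c + y22 * d) ->
    x21 * T = c * (y11 * a + y12 * b) + d * (y21 * a + y22 * b) ->
    x22 * T = c * (y11 * c + y12 * d) + d * (y21 * c + y22 * d) ->
    x31 * T = u1 * (y11 * a + y12 * b) + u2 * (y21 * a + y22 * b)
              + t * (y31 * a + y32 * b) ->
    x32 * T = u1 * (y11 * c + y12 * d) + u2 * (y21 * c + y22 * d)
              + t * (y31 * c + y32 * d) ->
    Q (W y11 y12 0 y21 y22 0 y31 y32 0) -> Q (W x11 x12 0 x21 x22 0 x31 x32 0).
  move=> D T D0 t0 E11 E12 E21 E22 E31 E32.
  apply: (base_change_move (a := a) (b := b) (c := c) (d := d)
    (u1 := u1) (u2 := u2) (v1 := 0) (v2 := 0) (t := t)) => //;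
    rewrite -/D -/T ?E11 ?E12 ?E21 ?E22 ?E31 ?E32; ring.
have RC (a b c d y11 y12 y21 y22 x11 x12 x21 x22 : 'F_p) :
    let D := a * d - b * c in let T := D * D in D != 0 ->
    x11 * T = a * (y11 * a + y12 * b) + b * (y21 * a + y22 * b) ->
    x12 * T = a * (y11 * c + y12 * d) + b * (y21 * c + y22 * d) ->
    x21 * T = c * (y11 * a + y12 * b) + d * (y21 * a + y22 * b) ->
    x22 * T = c * (y11 * c + y12 * d) + d * (y21 * c + y22 * d) ->
    R y11 y12 y21 y22 -> R x11 x12 x21 x22.
  move=> D T D0 E11 E12 E21 E22 [c1 [c2 Qy]].
  have T0 : T != 0 by rewrite mulf_neq0.
  exists (D * (c1 * a + c2 * b) / T), (D * (c1 * c + c2 * d) / T).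
  apply: (mv a b c d D 0 0 _ _ _ _ _ _ _ _ _ _ _ _ D0 D0 E11 E12 E21 E22 _ _ Qy).
    by rewrite -/D -/T divfK //; ring.
  by rewrite -/D -/T divfK //; ring.
(* For invertible A, the row u is the solution of u A = - c given by Cramer's rule. *)
have clear y11 y12 y21 y22 y31 y32 : y11 * y22 - y12 * y21 != 0 ->
    Q (W y11 y12 0 y21 y22 0 y31 y32 0) -> Q (W y11 y12 0 y21 y22 0 0 0 0).
  move=> det0; apply: (mv 1 0 0 1 1 (- (y31 * y22 - y32 * y21) / (y11 * y22 - y12 * y21))
    (- (y32 * y11 - y31 * y12) / (y11 * y22 - y12 * y21)));
    rewrite ?mul1r ?mul0r ?subr0 ?oner_neq0 //; try ring.
    by field.
  by field.
have scale a d t y11 y12 y21 y22 x11 x12 x21 x22 : a != 0 -> d != 0 -> t != 0 ->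
    x11 * t * d = y11 * a -> x12 * t = y12 -> x21 * t = y21 ->
    x22 * t * a = y22 * d ->
    Q (W y11 y12 0 y21 y22 0 0 0 0) -> Q (W x11 x12 0 x21 x22 0 0 0 0).
  move=> a0 d0 t0 E11 E12 E21 E22; apply: (mv a 0 0 d t 0 0);
    rewrite ?mul0r ?subr0 ?mulf_neq0 //; try ring.
  - by transitivity (x11 * t * d * a); [ring | rewrite E11; ring].
  - by transitivity (x12 * t * d * a); [ring | rewrite E12; ring].
  - by transitivity (x21 * t * d * a); [ring | rewrite E21; ring].
  by transitivity (x22 * t * a * d); [ring | rewrite E22; ring].
have one : in_1_eta eta 1 by left.
have Rx : R w11 w12 w21 w22 by exists w31, w32.
have n1 := oner_neq0 'F_p.
have op2 : ~~ odd p -> p = 2%N by case: (even_prime p_pr) => [|->].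
case: (block_reduction p_pr RC Rx) => [[R0 | RJ] | [[k k0 Rk] | Rn] | [op H] | [p2 [R1 | R1]]].
- have [c1 [c2 Qc]] := R0; have [z | nz] := boolP ((c1 == 0) && (c2 == 0)).
    apply: (fin _ _ _ _ _ _ _ _ _ (normal_0 (block_zero eta) _ _)) => //.
    by case/andP: z Qc => /eqP -> /eqP ->.
  apply: (fin _ _ _ _ _ _ _ _ _ (normal_c0 eta)).
  have [x [y D0]] : exists x y, x * c1 - y * - c2 != 0.
    move: nz; rewrite negb_and => /orP[c0 | c0]; [exists 1, 0 | exists 0, 1].
      by rewrite mul1r mul0r subr0.
    by rewrite mul1r mul0r sub0r opprK.
  by apply: (mv x y (- c2) c1 1 0 0 _ _ _ _ _ _ _ _ _ _ _ _ D0 n1 _ _ _ _ _ _ Qc); ring.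
- have [c1 [c2 Qc]] := RJ; have {}Qc : Q (W 0 (- 1) 0 1 0 0 0 0 0).
    by apply: clear Qc; rewrite mulr1 mulr0 sub0r opprK.
  have [op | op] := boolP (odd p).
    exact: (fin _ _ _ _ _ _ _ _ _ (normal_0 (block_alt eta op) _ _) Qc).
  apply: (fin _ _ _ _ _ _ _ _ _ (normal_0 (block_alt2 eta (op2 op)) _ _)) => //.
  by rewrite -[X in W 0 X](F2_neq0 (op2 op) (x := - 1)) ?oppr_eq0.
(* The free factor t absorbs k. The first column of A is zero, so u can clear c2 but not c1, and a
   nonzero c1 leads to a form of its own. *)
- have [c1 [c2 Qc]] := Rk; have [c10 | c10] := eqVneq c1 0.
    apply: (fin _ _ _ _ _ _ _ _ _ (normal_0 (block_sym1 one) _ _)) => //.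
    apply: (mv 1 0 0 1 k 0 (- c2) _ _ _ _ _ _ _ _ _ _ _ _ _ _ _ _ _ _ _ _ Qc);
      rewrite ?c10 ?mul1r ?mul0r ?subr0 //; ring.
  apply: (fin _ _ _ _ _ _ _ _ _ (normal_c1 eta)).
  apply: (mv 1 0 0 c1 (k * c1) 0 (- (c1 * c2)) _ _ _ _ _ _ _ _ _ _ _ _ _ _ _ _ _ _ _ _ Qc);
    rewrite ?mul1r ?mul0r ?subr0 ?mulf_neq0 //; ring.
- have [c1 [c2 Qc]] := Rn; have [c20 | c20] := eqVneq c2 0.
    apply: (fin _ _ _ _ _ _ _ _ _ (normal_0 (block_nilp eta) _ _)) => //.
    by apply: (mv 1 0 0 1 1 0 (- c1) _ _ _ _ _ _ _ _ _ _ _ _ _ _ _ _ _ _ _ _ Qc);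
      rewrite ?c20 ?mul1r ?mul0r ?subr0 //; ring.
  apply: (fin _ _ _ _ _ _ _ _ _ (normal_c2 eta)).
  apply: (mv c2 0 0 1 1 0 (- c1) _ _ _ _ _ _ _ _ _ _ _ _ _ _ _ _ _ _ _ _ Qc);
    rewrite ?mulr1 ?mul0r ?subr0 //; ring.
- case: H => a [k [b [a0 det0 [c1 [c2 Qc]]]]].
  have {c1 c2}Qc : Q (W a (- k) 0 k b 0 0 0 0).
    by apply: clear Qc; rewrite mulNr opprK.
  have [k0 | k0] := eqVneq k 0.
    have b0 : b != 0 by apply: contraNneq det0 => ->; rewrite k0 !mulr0 addr0.
    have ba0 : b / a != 0 by rewrite mulf_neq0 ?invr_eq0.
    have [nu [z [hnu z0 baE]]] := square_classes p_pr nsq ba0.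
    apply: (fin _ _ _ _ _ _ _ _ _ (normal_0 (block_sym2 hnu) _ _)) => //.
    have bE : b = nu * z ^+ 2 * a by rewrite -baE divfK.
    by apply: (scale z 1 (a * z) _ _ _ _ _ _ _ _ _ _ _ _ _ _ _ Qc);
      rewrite ?mulf_neq0 ?k0 ?bE //; ring.
  have [b0 | b0] := eqVneq b 0.
    apply: (fin _ _ _ _ _ _ _ _ _ (normal_0 (block_alt_sym1 op one) _ _)) => //.
    by apply: (scale k a k _ _ _ _ _ _ _ _ _ _ _ _ _ _ _ Qc); rewrite ?b0 //; ring.
  (* Diagonal changes multiply the two diagonal entries by inverse ratios, up to the common 1 / t
     that also scales k. Only a b / k^2 survives, and it is the parameter r. *)
  have r0 : a * b / (k * k) != 0 by rewrite !mulf_neq0 ?invr_eq0 ?mulf_neq0.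
  have r1 : a * b / (k * k) != - 1.
    apply: contraNneq det0 => rE.
    have -> : a * b + k * k = (a * b / (k * k) + 1) * (k * k) by field.
    by rewrite rE addNr mul0r.
  apply: (fin _ _ _ _ _ _ _ _ _ (normal_0 (block_alt_sym2 eta op r0 r1) _ _)) => //.
  by apply: (scale k a k _ _ _ _ _ _ _ _ _ _ _ _ _ _ _ Qc) => //; try ring; field.
- have [c1 [c2 Qc]] := R1.
  apply: (fin _ _ _ _ _ _ _ _ _ (normal_0 (block_sym2 one) _ _)) => //.
  by apply: clear Qc; rewrite mulr1 mulr0 subr0.
have [c1 [c2 Qc]] := R1.
apply: (fin _ _ _ _ _ _ _ _ _ (normal_0 (block_nonsym2 eta p2) _ _)) => //.
by apply: clear Qc; rewrite mulr1 mulr0 subr0.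
Qed.

Lemma normal_form_exists (w : 'M['F_p]_3) : Q w ->
  exists x11 x12 x13 x21 x22 x23 x31 x32 x33,
    normal_form eta x11 x12 x13 x21 x22 x23 x31 x32 x33 /\
    Q (W x11 x12 x13 x21 x22 x23 x31 x32 x33).
Proof.
have [w11 [w12 [w13 [w21 [w22 [w23 [w31 [w32 [w33 ->]]]]]]]]] := mx3_surj w.
move=> Qw; have [b0 | nb0] := boolP ((w13 != 0) || (w23 != 0)).
  exact: normal_form_b b0 Qw.
move: nb0; rewrite negb_or !negbK => /andP[/eqP b1 /eqP b2]; rewrite b1 b2 in Qw.
have [e0 | e0] := eqVneq w33 0; first by rewrite e0 in Qw; apply: normal_form_0 Qw.
have [i [x11 [x12 [x21 [x22 [B Qx]]]]]] := normal_form_e e0 Qw.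
by exists x11, x12, 0, x21, x22, 0, 0, 0, 1; split=> //; apply: normal_e B.
Qed.

End Reduction.

(** * Distinct normal forms are not related by changes of generators *)

Section Uniqueness.

Variables (p : nat) (eta : 'F_p).
Hypotheses (p_pr : prime p)
  (nsq : odd p -> ~ (exists x : 'F_p, x ^+ 2 = eta)).

Lemma in_1_eta_neq0 nu : in_1_eta eta nu -> nu != 0.
Proof.
case=> [-> | [op ->]]; first exact: oner_neq0.
by apply/eqP => e0; apply: (nsq op); exists 0; rewrite e0 expr0n.
Qed.

Lemma in_1_eta_eq nu nu' x y : in_1_eta eta nu -> in_1_eta eta nu' ->
  x != 0 -> nu' * x ^+ 2 = nu * y ^+ 2 -> nu = nu'.
Proof.
move=> [-> | [op ->]] [-> | [op' ->]] // x0 E.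
  case: (nsq op'); exists (y / x).
  by rewrite expr_div_n -[y ^+ 2]mul1r -E mulfK // expf_neq0.
have y0 : y != 0.
  apply: contraNneq x0 => y0; move: E; rewrite y0 mul1r expr0n mulr0 => /eqP.
  by rewrite expf_eq0.
case: (nsq op); exists (x / y).
by rewrite expr_div_n -[x ^+ 2]mul1r E mulfK // expf_neq0.
Qed.

Definition congruent (a b c d t w11 w12 w21 w22 x11 x12 x21 x22 : 'F_p) : Prop :=
  let D := a * d - b * c in let T := t * D in
  [/\ D != 0, t != 0,
      x11 * T = a * (w11 * a + w12 * b) + b * (w21 * a + w22 * b)
      /\ x12 * T = a * (w11 * c + w12 * d) + b * (w21 * c + w22 * d),
      x21 * T = c * (w11 * a + w12 * b) + d * (w21 * a + w22 * b)
    & x22 * T = c * (w11 * c + w12 * d) + d * (w21 * c + w22 * d)].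

(* Every test is the vanishing of relative invariants of congruence, with the
   alternating part, the determinant and four times the determinant of the
   symmetric part among them. *)
Definition block_class (w11 w12 w21 w22 : 'F_p) : nat :=
  let k := w12 - w21 in let s := w12 + w21 in
  if [&& w11 == 0, w12 == 0, w21 == 0 & w22 == 0] then 0
  else if w11 * w22 - w12 * w21 == 0 then (if k == 0 then 1 else 2)
  else if [&& w11 == 0, w22 == 0 & s == 0] then (if k == 0 then 3 else 5)
  else if k == 0 then 4
  else if 4%:R * (w11 * w22) - s ^+ 2 == 0 then 6 else 7.

Lemma block_classE i w11 w12 w21 w22 :
  reduced_block eta i w11 w12 w21 w22 -> block_class w11 w12 w21 w22 = i.
Proof.
have n1 : (1 : 'F_p) == 0 = false by apply/negbTE/oner_neq0.
have n2 (op : odd p) : (- 1 - 1 : 'F_p) == 0 = false.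
  by apply/negbTE; rewrite -opprD oppr_eq0; apply: two_neq0_Fp.
have n4 (op : odd p) : (4%:R : 'F_p) == 0 = false.
  by apply/negbTE; rewrite (natrM _ 2 2) mulf_neq0 // two_neq0_Fp.
have p2 : p = 2%N -> (2%:R : 'F_p) = 0 by move=> p2; rewrite -[in LHS]p2 pchar_Fp_0.
rewrite /block_class; case=> {i w11 w12 w21 w22}.
- by rewrite eqxx.
- move=> nu /in_1_eta_neq0/negbTE nu0.
  by rewrite nu0 eqxx andbF !mul0r subr0 eqxx.
- by rewrite !eqxx n1 !mul0r subr0 sub0r oppr_eq0 n1 eqxx.
- move=> q; have -> : (1 + 1 : 'F_p) = 0 by rewrite -(p2 q).
  by rewrite !eqxx n1 mul0r mulr1 sub0r oppr_eq0 n1 subrr eqxx.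
- move=> nu /in_1_eta_neq0/negbTE nu0.
  by rewrite n1 mul1r mul0r subr0 nu0 /= subr0 eqxx.
- move=> op; rewrite oppr_eq0 n1 !eqxx /= mul0r mulr1 sub0r opprK n1 addNr eqxx.
  by rewrite n2.
- move=> nu op /in_1_eta_neq0/negbTE nu0.
  rewrite nu0 /= mulr0 mulr1 sub0r opprK n1 n2 // addNr expr0n subr0.
  by rewrite mulr0 eqxx.
- move=> r op /negbTE r0; rewrite -addr_eq0 => /negbTE r1.
  rewrite n1 /= mul1r mulr1 opprK r1 n2 // addNr expr0n subr0.
  by rewrite mulf_eq0 n4 // r0.
move=> q; rewrite n1 /= mulr1 mulr0 subr0 n1 addr0 expr1n.
by rewrite mulr1 (natrM _ 2 2) (p2 q) mul0r sub0r oppr_eq0 n1.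
Qed.

(** Each test of [block_class] is shown to pass from the old block to the new one; the second
    congruence gives the converse, so no inverse change has to be computed. *)
Lemma block_class_congruent w11 w12 w21 w22 x11 x12 x21 x22
    a b c d t a' b' c' d' t' :
  congruent a b c d t w11 w12 w21 w22 x11 x12 x21 x22 ->
  congruent a' b' c' d' t' x11 x12 x21 x22 w11 w12 w21 w22 ->
  block_class w11 w12 w21 w22 = block_class x11 x12 x21 x22.
Proof.
have two (f : 'F_p -> 'F_p -> 'F_p -> 'F_p -> bool) :
  (forall a b c d t w11 w12 w21 w22 x11 x12 x21 x22,
     congruent a b c d t w11 w12 w21 w22 x11 x12 x21 x22 ->
     f w11 w12 w21 w22 -> f x11 x12 x21 x22) ->
  congruent a b c d t w11 w12 w21 w22 x11 x12 x21 x22 ->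
  congruent a' b' c' d' t' x11 x12 x21 x22 w11 w12 w21 w22 ->
  f w11 w12 w21 w22 = f x11 x12 x21 x22.
  by move=> H h1 h2; apply/idP/idP; [exact: H h1 | exact: H h2].
have inv (x y u v : 'F_p) : u != 0 -> x * u = y * v -> y == 0 -> x == 0.
  move=> u0 E /eqP y0; move/eqP: E; rewrite y0 mul0r mulf_eq0 (negbTE u0) orbF.
  by [].
move=> h1 h2.
have e1 : [&& w11 == 0, w12 == 0, w21 == 0 & w22 == 0] =
    [&& x11 == 0, x12 == 0, x21 == 0 & x22 == 0].
  apply: (two (fun w11 w12 w21 w22 => [&& w11 == 0, w12 == 0, w21 == 0 & w22 == 0])
    _ h1 h2) => {h1 h2} p1 p2 p3 p4 s v11 v12 v21 v22 y11 y12 y21 y22.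
  case=> D0 s0 [E11 E12] E21 E22; have T0 := mulf_neq0 s0 D0.
  case/and4P => /eqP z1 /eqP z2 /eqP z3 /eqP z4.
  rewrite z1 z2 z3 z4 in E11 E12 E21 E22.
  apply/and4P; split; apply: (inv _ 0 _ 0 T0); rewrite ?E11 ?E12 ?E21 ?E22 //; ring.
have e2 : (w11 * w22 - w12 * w21 == 0) = (x11 * x22 - x12 * x21 == 0).
  apply: (two (fun w11 w12 w21 w22 => w11 * w22 - w12 * w21 == 0)
    _ h1 h2) => {h1 h2} p1 p2 p3 p4 s v11 v12 v21 v22 y11 y12 y21 y22.
  case=> D0 s0 [E11 E12] E21 E22; have T0 := mulf_neq0 s0 D0.
  apply: (inv _ _ _ ((p1 * p4 - p2 * p3) ^+ 2) (mulf_neq0 T0 T0)).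
  transitivity (y11 * (s * (p1 * p4 - p2 * p3)) * (y22 * (s * (p1 * p4 - p2 * p3))) - y12 * (s * (p1 * p4 - p2 * p3)) * (y21 * (s * (p1 * p4 - p2 * p3)))); first by ring.
  by rewrite E11 E12 E21 E22; ring.
have e3 : (w12 - w21 == 0) = (x12 - x21 == 0).
  apply: (two (fun w11 w12 w21 w22 => w12 - w21 == 0)
    _ h1 h2) => {h1 h2} p1 p2 p3 p4 s v11 v12 v21 v22 y11 y12 y21 y22.
  case=> D0 s0 [E11 E12] E21 E22; have T0 := mulf_neq0 s0 D0.
  apply: (inv _ _ _ (p1 * p4 - p2 * p3) T0).
  by rewrite mulrBl E12 E21; ring.
have e4 : [&& w11 == 0, w22 == 0 & w12 + w21 == 0] =
    [&& x11 == 0, x22 == 0 & x12 + x21 == 0].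
  apply: (two (fun w11 w12 w21 w22 => [&& w11 == 0, w22 == 0 & w12 + w21 == 0])
    _ h1 h2) => {h1 h2} p1 p2 p3 p4 s v11 v12 v21 v22 y11 y12 y21 y22.
  case=> D0 s0 [E11 E12] E21 E22; have T0 := mulf_neq0 s0 D0.
  case/and3P => /eqP z1 /eqP z2; rewrite addr_eq0 => /eqP z3.
  rewrite z1 z2 z3 in E11 E12 E21 E22.
  apply/and3P; split; apply: (inv _ 0 _ 0 T0); rewrite ?mulrDl ?E11 ?E12 ?E21 ?E22 //; ring.
have e5 : (4%:R * (w11 * w22) - (w12 + w21) ^+ 2 == 0) =
    (4%:R * (x11 * x22) - (x12 + x21) ^+ 2 == 0).
  apply: (two (fun w11 w12 w21 w22 => 4%:R * (w11 * w22) - (w12 + w21) ^+ 2 == 0)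
    _ h1 h2) => {h1 h2} p1 p2 p3 p4 s v11 v12 v21 v22 y11 y12 y21 y22.
  case=> D0 s0 [E11 E12] E21 E22; have T0 := mulf_neq0 s0 D0.
  apply: (inv _ _ _ ((p1 * p4 - p2 * p3) ^+ 2) (mulf_neq0 T0 T0)).
  transitivity (4%:R * (y11 * (s * (p1 * p4 - p2 * p3)) * (y22 * (s * (p1 * p4 - p2 * p3)))) -
    (y12 * (s * (p1 * p4 - p2 * p3)) + y21 * (s * (p1 * p4 - p2 * p3))) ^+ 2); first by ring.
  by rewrite E11 E12 E21 E22; ring.
by rewrite /block_class e1 e2 e3 e4 e5.
Qed.

(** The new alternating part is the old one divided by t, and the new determinant is the old one
    divided by t^2. For odd p an alternating part fixed by the normal form gives t = 1, and then the
    determinant gives r; a parameter nu is pinned down modulo squares. The final disjunction records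
    the two regimes: e = 1 forces t = D, while e = 0 leaves t free but admits only nu = 1 in
    families 1 and 6. *)
Lemma reduced_block_unique i a b c d t w11 w12 w21 w22 x11 x12 x21 x22 :
  reduced_block eta i w11 w12 w21 w22 -> reduced_block eta i x11 x12 x21 x22 ->
  congruent a b c d t w11 w12 w21 w22 x11 x12 x21 x22 ->
  t = a * d - b * c \/
    [/\ i = 1%N -> w22 = 1, i = 6%N -> w11 = 1,
        i = 1%N -> x22 = 1 & i = 6%N -> x11 = 1] ->
  [/\ w11 = x11, w12 = x12, w21 = x21 & w22 = x22].
Proof.
move=> B1 B2 [D0 t0 [E11 E12] E21 E22].
have T0 := mulf_neq0 t0 D0.
have kE : (x12 - x21) * t = w12 - w21.
  apply: (mulIf D0); transitivity (x12 * (t * (a * d - b * c)) - x21 * (t * (a * d - b * c))); first by ring.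
  by rewrite E12 E21; ring.
have detE : (x11 * x22 - x12 * x21) * t ^+ 2 = w11 * w22 - w12 * w21.
  apply: (mulIf (mulf_neq0 D0 D0)).
  transitivity (x11 * (t * (a * d - b * c)) * (x22 * (t * (a * d - b * c))) - x12 * (t * (a * d - b * c)) * (x21 * (t * (a * d - b * c)))); first by ring.
  by rewrite E11 E12 E21 E22; ring.
have two0 (op : odd p) : (- 1 - 1 : 'F_p) != 0.
  by rewrite -opprD oppr_eq0; apply: two_neq0_Fp.
have t1 : odd p -> (- 1 - 1) * t = - 1 - 1 -> t = 1.
  by move=> /two0 h; rewrite -[RHS]mulr1 => /(mulfI h).
move=> H; move: B2; case: B1 E11 E12 E21 E22 kE detE H => {i w11 w12 w21 w22}.
- by move=> _ _ _ _ _ _ _ B2; inversion B2.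
- move=> nu hnu E11 E12 E21 E22 kE detE H B2.
  inversion B2 as [|nu' hnu' e1 e2 e3 e4 e5| | | | | | |]; subst x11 x12 x21 x22.
  case: H => [tD | [/(_ erefl) h _ /(_ erefl) h' _]]; last by rewrite h h'.
  split=> //; apply: (in_1_eta_eq (y := d) hnu hnu' D0).
  by rewrite -{1}tD in E22 *; move: E22; rewrite tD => E22; rewrite expr2 E22; ring.
- by move=> _ _ _ _ _ _ _ B2; inversion B2.
- by move=> p2 _ _ _ _ _ _ _ B2; inversion B2.
- move=> nu hnu E11 E12 E21 E22 kE detE H B2.
  inversion B2 as [| | | |nu' hnu' e1 e2 e3 e4 e5| | | |]; subst x11 x12 x21 x22.
  split=> //; apply: (in_1_eta_eq (y := 1) hnu hnu' t0).
  by move: detE; rewrite !mul1r !mul0r !subr0 expr1n mulr1.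
- by move=> op _ _ _ _ _ _ _ B2; inversion B2.
- move=> nu op hnu E11 E12 E21 E22 kE detE H B2.
  inversion B2 as [| | | | | |nu' op' hnu' e1 e2 e3 e4 e5| |]; subst x11 x12 x21 x22.
  have tt := t1 op kE.
  case: H => [tD | [_ /(_ erefl) h _ /(_ erefl) h']]; last by rewrite h h'.
  split=> //; apply: (in_1_eta_eq (y := a) hnu hnu' (oner_neq0 _)).
  rewrite -tD tt in E11; rewrite expr1n -[1]mul1r E11; ring.
- move=> r op r0 r1 E11 E12 E21 E22 kE detE H B2.
  inversion B2 as [| | | | | | |r' op' r0' r1' e1 e2 e3 e4 e5|p2]; subst x11 x12 x21 x22; last first.
    by rewrite p2 in op.
  have tt := t1 op kE; split=> //.
  by move: detE; rewrite tt expr1n mulr1 !mul1r => /addIr ->.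
move=> p2 E11 E12 E21 E22 kE detE H B2.
inversion B2 as [| | | | | | |r' op' r0' r1' e1 e2 e3 e4 e5|]; subst x11 x12 x21 x22 => //.
by rewrite p2 in op'.
Qed.

Definition corner_row (i : nat) (c1 c2 : 'F_p) : Prop :=
  [\/ c1 = 0 /\ c2 = 0, i = 0%N /\ (c1 = 1 /\ c2 = 0),
      i = 1%N /\ (c1 = 1 /\ c2 = 0) | i = 2%N /\ (c1 = 0 /\ c2 = 1)].

Lemma normal_form_cases w11 w12 w13 w21 w22 w23 w31 w32 w33 :
  normal_form eta w11 w12 w13 w21 w22 w23 w31 w32 w33 ->
  [/\ w13 = 0, w23 = 0 & exists2 i, reduced_block eta i w11 w12 w21 w22 &
    [/\ w33 = 1, w31 = 0 & w32 = 0] \/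
    [/\ w33 = 0, i = 1%N -> w22 = 1, i = 6%N -> w11 = 1 & corner_row i w31 w32]] \/
  [/\ w13 = 0, w23 = 1, w33 = 0, w21 = 0 & w22 = 0].
Proof.
have one : in_1_eta eta 1 by left.
case=> {w11 w12 w13 w21 w22 w23 w31 w32 w33}.
- by move=> i a11 a12 a21 a22 B; left; split=> //; exists i => //; left.
- move=> i a11 a12 a21 a22 B h1 h6; left; split=> //; exists i => //; right.
  by split=> //; constructor 1.
- left; split=> //; exists 0%N; first exact: block_zero.
  by right; split=> //; constructor 2.
- left; split=> //; exists 1%N; first exact: block_sym1.
  by right; split=> //; constructor 3.
- left; split=> //; exists 2%N; first exact: block_nilp.
  by right; split=> //; constructor 4.
all: by right.
Qed.

(** Multiplying the upper rows by the transpose of P cancels the cofactor matrix and leaves the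
    scalar t D, which turns the matrix equation into a congruence of blocks. *)
Lemma base_change_block w11 w12 w21 w22 w31 w32 w33 x11 x12 x21 x22 x31 x32 x33 :
  base_change (mx3 w11 w12 0 w21 w22 0 w31 w32 w33)
    (mx3 x11 x12 0 x21 x22 0 x31 x32 x33) ->
  exists a b c d u1 u2 v1 v2 t,
  [/\ congruent a b c d t w11 w12 w21 w22 x11 x12 x21 x22,
      u1 * w11 + u2 * w21 + t * w31 =
        x31 * (t * d) - x32 * (t * b) + x33 * (b * v2 - v1 * d),
      u1 * w12 + u2 * w22 + t * w32 =
        - x31 * (t * c) + x32 * (t * a) + x33 * (v1 * c - a * v2)
    & t * w33 = x33 * (a * d - b * c)].
Proof.
case=> a [b [c [d [u1 [u2 [v1 [v2 [t [D0 t0]]]]]]]]]; rewrite !mx3_mul => /mx3_inj[].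
case=> E11 E12 _ [E21 E22 _] [E31 E32 E33].
exists a, b, c, d, u1, u2, v1, v2, t; split.
- split=> //.
  + split.
      transitivity (a * (a * w11 + b * w21 + 0 * w31) + b * (a * w12 + b * w22 + 0 * w32));
        last by ring.
      by rewrite E11 E12; ring.
    transitivity (c * (a * w11 + b * w21 + 0 * w31) + d * (a * w12 + b * w22 + 0 * w32));
      last by ring.
    by rewrite E11 E12; ring.
  + transitivity (a * (c * w11 + d * w21 + 0 * w31) + b * (c * w12 + d * w22 + 0 * w32));
      last by ring.
    by rewrite E21 E22; ring.
  transitivity (c * (c * w11 + d * w21 + 0 * w31) + d * (c * w12 + d * w22 + 0 * w32));
    last by ring.
  by rewrite E21 E22; ring.
- by rewrite E31; ring.
- by rewrite E32; ring.
by transitivity (u1 * 0 + u2 * 0 + t * w33); [ring | rewrite E33; ring].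
Qed.

Lemma corner_row_zero i a b c d t u1 u2 w11 w12 w21 w22 x31 x32 :
  congruent a b c d t w11 w12 w21 w22 w11 w12 w21 w22 ->
  reduced_block eta i w11 w12 w21 w22 -> (i = 1%N -> w22 = 1) ->
  corner_row i x31 x32 ->
  u1 * w11 + u2 * w21 = x31 * (t * d) - x32 * (t * b) ->
  u1 * w12 + u2 * w22 = - x31 * (t * c) + x32 * (t * a) ->
  x31 = 0 /\ x32 = 0.
Proof.
case=> D0 t0 [E11 E12] E21 E22 B h1 [[-> ->] // | [i0 [-> ->]] | [i1 [-> ->]] | [i2 [-> ->]]].
- rewrite i0 in B; have [z1 z2 z3 z4] : [/\ w11 = 0, w12 = 0, w21 = 0 & w22 = 0].
    by inversion B.
  rewrite z1 z2 z3 z4 !mulr0 !mul1r !mul0r subr0 addr0 mulN1r => /esym/eqP.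
  rewrite mulf_eq0 (negbTE t0) => /eqP d0 /esym/eqP.
  rewrite addr0 oppr_eq0 mulf_eq0 (negbTE t0) => /eqP c0.
  by rewrite c0 d0 !mulr0 subrr eqxx in D0.
- rewrite i1 in B; have [z1 z2 z3] : [/\ w11 = 0, w12 = 0 & w21 = 0].
    by inversion B.
  rewrite z1 z2 z3 (h1 i1) !mulr0 !mul1r !mul0r subr0 addr0 => /esym/eqP.
  rewrite mulf_eq0 (negbTE t0) => /eqP d0 _; move: E22.
  rewrite z1 z2 z3 (h1 i1) d0 mul1r => T0; case/eqP: (mulf_neq0 t0 D0).
  by rewrite d0 T0; ring.
rewrite i2 in B; have [z1 z2 z3 z4] : [/\ w11 = 0, w12 = 0, w21 = 1 & w22 = 0].
  by inversion B.
rewrite z1 z2 z3 z4 !mulr0 addr0 => _ /esym/eqP.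
rewrite oppr0 mul0r mul1r add0r mulf_eq0 (negbTE t0) => /eqP a0; move: E21.
rewrite z1 z2 z3 z4 a0 mul1r => T0; case/eqP: (mulf_neq0 t0 D0).
by rewrite a0 T0; ring.
Qed.

(** Preserving b = e_2 and e = 0 forces b = 0, a = 1 and u2 = 0 in the change, leaving only c, d, t,
    u1. The implications in [go], used in both directions, then separate the families and identify
    their parameters. *)
Lemma normal_form_b_unique w11 w12 w31 w32 x11 x12 x31 x32 :
  normal_form eta w11 w12 0 0 0 1 w31 w32 0 ->
  normal_form eta x11 x12 0 0 0 1 x31 x32 0 ->
  base_change (mx3 w11 w12 0 0 0 1 w31 w32 0) (mx3 x11 x12 0 0 0 1 x31 x32 0) ->
  base_change (mx3 x11 x12 0 0 0 1 x31 x32 0) (mx3 w11 w12 0 0 0 1 w31 w32 0) ->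
  [/\ w11 = x11, w12 = x12, w31 = x31 & w32 = x32].
Proof.
have bE y11 y12 y31 y32 z11 z12 z31 z32 :
    base_change (mx3 y11 y12 0 0 0 1 y31 y32 0) (mx3 z11 z12 0 0 0 1 z31 z32 0) ->
    exists c d t u, [/\ d != 0, t != 0,
      y11 = z11 * (t * d) /\ y12 = - z11 * (t * c) + z12 * t,
      u * y11 + t * y31 = z31 * (t * d)
      & u * y12 + t * y32 = - z31 * (t * c) + z32 * t].
  case=> a [b [c [d [u1 [u2 [v1 [v2 [t [D0 t0]]]]]]]]]; rewrite !mx3_mul => /mx3_inj[].
  case=> E11 E12 E13 [E21 E22 E23] [E31 E32 E33].
  have b0 : b = 0.
    by transitivity (a * 0 + b * 1 + 0 * 0); [ring | rewrite E13; ring].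
  have dD : d = a * d.
    by transitivity (c * 0 + d * 1 + 0 * 0); [ring | rewrite E23 b0; ring].
  have d0 : d != 0 by apply: contraNneq D0 => ->; rewrite b0 mulr0 mul0r subr0.
  have a1 : a = 1 by apply: (mulIf d0); rewrite mul1r.
  have u20 : u2 = 0.
    by transitivity (u1 * 0 + u2 * 1 + t * 0); [ring | rewrite E33; ring].
  exists c, d, t, u1; split=> //.
  - split.
      by transitivity (a * y11 + b * 0 + 0 * y31); [rewrite a1; ring | rewrite E11 b0; ring].
    by transitivity (a * y12 + b * 0 + 0 * y32); [rewrite a1; ring | rewrite E12 a1; ring].
  - by transitivity (u1 * y11 + u2 * 0 + t * y31); [ring | rewrite E31 b0; ring].
  by transitivity (u1 * y12 + u2 * 0 + t * y32); [ring | rewrite E32 a1; ring].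
have n1 := oner_neq0 'F_p.
have go y11 y12 y31 y32 z11 z12 z31 z32 :
    base_change (mx3 y11 y12 0 0 0 1 y31 y32 0) (mx3 z11 z12 0 0 0 1 z31 z32 0) ->
    [/\ y11 = 0 -> z11 = 0, y11 = 0 -> y12 = 0 -> z12 = 0,
      y11 = 0 -> y31 = 0 -> z31 = 0, y11 = 0 -> y12 = 0 -> z31 = 0 -> y32 = z32
      & y11 = 1 -> y12 = 0 -> y31 = 0 -> z12 = 0 -> z31 = 0 -> z11 = 1 -> y32 = z32].
  case/bE => c [d [t [u [d0 t0 [E11 E12] E31 E32]]]].
  have td0 := mulf_neq0 t0 d0.
  have z11_0 : y11 = 0 -> z11 = 0.
    by move=> y0; apply: (mulIf td0); rewrite -E11 y0 mul0r.
  split=> //.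
  - move=> /z11_0 z0 y0; apply: (mulIf t0); rewrite mul0r -y0 E12 z0; ring.
  - by move=> y0 y0'; apply: (mulIf td0); rewrite -E31 y0 y0'; ring.
  - move=> y0 y0' z0; apply: (mulIf t0).
    by transitivity (u * y12 + t * y32); [rewrite y0'; ring | rewrite E32 z0; ring].
  move=> y1 y0 y0' z0 z0' z1; apply: (mulIf t0).
  have u0 : u = 0.
    by transitivity (u * y11 + t * y31); [rewrite y1 y0'; ring | rewrite E31 z0'; ring].
  by transitivity (u * y12 + t * y32); [rewrite u0; ring | rewrite E32 z0'; ring].
move=> Nw Nx /go[A1 A2 A3 A4 A5] /go[B1 B2 B3 B4 B5].
have z1 : (0 : 'F_p) <> 1 by apply/eqP; rewrite eq_sym.
have b23 : (1 : 'F_p) <> 0 by apply/eqP.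
(* [z1] and [b23] discard the pairs in which an entry 0 would have to equal an entry 1. *)
inversion Nw; inversion Nx; subst; split=> //; try (by exfalso; auto 6); try (by symmetry; auto).
Qed.

Lemma normal_form_unique w11 w12 w13 w21 w22 w23 w31 w32 w33
    x11 x12 x13 x21 x22 x23 x31 x32 x33 :
  let w := mx3 w11 w12 w13 w21 w22 w23 w31 w32 w33 in
  let x := mx3 x11 x12 x13 x21 x22 x23 x31 x32 x33 in
  normal_form eta w11 w12 w13 w21 w22 w23 w31 w32 w33 ->
  normal_form eta x11 x12 x13 x21 x22 x23 x31 x32 x33 ->
  base_change w x -> base_change x w -> w = x.
Proof.
move=> w x Nw Nx; rewrite {}/w {}/x.
(* If b = 0, the entry in row 2 and column 3 of the matrix equation reads 0 = D. *)
have excl (y11 y12 y21 y22 y31 y32 y33 z11 z12 z31 z32 : 'F_p) :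
    base_change (mx3 y11 y12 0 y21 y22 0 y31 y32 y33)
                (mx3 z11 z12 0 0 0 1 z31 z32 0) -> False.
  case=> a [b [c [d [u1 [u2 [v1 [v2 [t [D0 t0]]]]]]]]]; rewrite !mx3_mul => /mx3_inj[].
  case=> _ _ _ [_ _ E23] _; case/eqP: D0.
  by transitivity (c * 0 + d * 0 + 0 * y33); [rewrite E23; ring | ring].
case: (normal_form_cases Nw) (normal_form_cases Nx) => [[-> -> [i Bw Hw]] | Hw]
    [[-> -> [j Bx Hx]] | Hx]; last first.
- case: Hw Hx Nw Nx => [-> -> -> -> ->] [-> -> -> -> ->] Nw Nx h1 h2.
  by have [-> -> -> ->] := normal_form_b_unique Nw Nx h1 h2.
- by case: Hw => [-> -> -> -> ->] _ /excl.
- by case: Hx => [-> -> -> -> ->] /excl.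
case/base_change_block => a [b [c [d [u1 [u2 [v1 [v2 [t [C E31 E32 E33]]]]]]]]].
case/base_change_block => a' [b' [c' [d' [u1' [u2' [v1' [v2' [t' [C' F31 F32 F33]]]]]]]]].
have ij : i = j.
  by rewrite -(block_classE Bw) -(block_classE Bx) (block_class_congruent C C').
subst j; have n1 := oner_neq0 'F_p.
case: Hw E31 E32 E33 F31 F32 F33 => [[-> -> ->] | [-> hw1 hw6 cw]];
  case: Hx => [[-> -> ->] | [-> hx1 hx6 cx]] E31 E32 E33 F31 F32 F33.
- have [|-> -> -> ->] // := reduced_block_unique Bw Bx C.
  (* With e = 1 on both sides the corner entry says t = D. *)
  by left; rewrite -[t]mulr1 E33 mul1r.
- by case: C => _ t0 _ _ _; move/eqP: E33; rewrite mulr1 mul0r (negbTE t0).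
- by case: C' => _ t0 _ _ _; move/eqP: F33; rewrite mulr1 mul0r (negbTE t0).
have [|e11 e12 e21 e22] := reduced_block_unique Bw Bx C; first by right.
subst x11 x12 x21 x22; rewrite !mul0r !addr0 in E31 E32 F31 F32.
have zero : w31 = 0 /\ w32 = 0 -> x31 = 0 /\ x32 = 0.
  case=> z1 z2; rewrite z1 z2 !mulr0 !addr0 in E31 E32.
  exact: corner_row_zero C Bw hw1 cx E31 E32.
have zero' : x31 = 0 /\ x32 = 0 -> w31 = 0 /\ w32 = 0.
  case=> z1 z2; rewrite z1 z2 !mulr0 !addr0 in F31 F32.
  exact: corner_row_zero C' Bw hw1 cw F31 F32.
case: cw zero zero' => [[-> ->] | [i0 [-> ->]] | [i0 [-> ->]] | [i0 [-> ->]]];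
  case: cx => [[-> ->] | [j0 [-> ->]] | [j0 [-> ->]] | [j0 [-> ->]]] // z z'.
all: try by case: (z (conj erefl erefl)) => /eqP; rewrite ?(negbTE n1) // => _ /eqP;
  rewrite (negbTE n1).
all: try by case: (z' (conj erefl erefl)) => /eqP; rewrite ?(negbTE n1) // => _ /eqP;
  rewrite (negbTE n1).
all: by rewrite i0 in j0.
Qed.

End Uniqueness.

Close Scope ring_scope.
Close Scope group_scope.

Theorem theorem5p1 (p m1 m2 m3 : nat) (eta : 'F_p) :
  prime p ->
  (odd p -> ~ (exists x : 'F_p, (x ^+ 2)%R = eta)) ->
  m1 = m2 -> m3 < m2 -> 1 <= m3 ->
  (forall (gT : finGroupType) (G : {group gT}),
     p_group_of_type p m1 m2 m3 G ->
     exists (a1 a2 a3 : gT) (w : 'M['F_p]_3),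
       characteristic_generators m1 m2 m3 G a1 a2 a3 w /\
       listed_matrix eta w)
  /\
  (forall (gT hT : finGroupType) (G : {group gT}) (H : {group hT})
          (w w' : 'M['F_p]_3),
     p_group_of_type p m1 m2 m3 G ->
     p_group_of_type p m1 m2 m3 H ->
     characteristic_matrix m1 m2 m3 G w ->
     characteristic_matrix m1 m2 m3 H w' ->
     listed_matrix eta w -> listed_matrix eta w' ->
     w <> w' ->
     ~ (isog G H)).
Proof.
move=> p_pr nsq m12 lt32 m3_gt0; subst m1; split.
  move=> gT G GT; have [b1 [b2 [b3 [v Cv]]]] := characteristic_generators_exist p_pr GT.
  have Qv : characteristic_matrix m2 m2 m3 G v by exists b1, b2, b3.
  have Qc (w w' : 'M['F_p]_3) : characteristic_matrix m2 m2 m3 G w -> base_change w w' ->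
      characteristic_matrix m2 m2 m3 G w'.
    exact: (base_change_characteristic p_pr lt32 m3_gt0 GT).
  have [x11 [x12 [x13 [x21 [x22 [x23 [x31 [x32 [x33 [N [a1 [a2 [a3 Ca]]]]]]]]]]]]] :=
    normal_form_exists p_pr nsq Qc Qv.
  exists a1, a2, a3, (mx3 x11 x12 x13 x21 x22 x23 x31 x32 x33); split=> //.
  exact: normal_form_listed.
move=> gT hT G H w w' GT HT Cw Cw' Lw Lw' ww' isoGH; apply: ww'.
have [a1 [a2 [a3 Ca]]] := Cw.
(* Both matrices now belong to G, so comparing the two systems of generators gives a change in each
   direction. *)
have [b1 [b2 [b3 Cb]]] : characteristic_matrix m2 m2 m3 G w'.
  by apply: characteristic_matrix_isog Cw'; rewrite // isog_sym.
have h1 := base_change_of_generators p_pr lt32 m3_gt0 GT Ca Cb.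
have h2 := base_change_of_generators p_pr lt32 m3_gt0 GT Cb Ca.
have [w11 [w12 [w13 [w21 [w22 [w23 [w31 [w32 [w33 [Ew Nw]]]]]]]]]] :=
  listed_normal_form p_pr Lw.
have [x11 [x12 [x13 [x21 [x22 [x23 [x31 [x32 [x33 [Ex Nx]]]]]]]]]] :=
  listed_normal_form p_pr Lw'.
by subst w w'; apply: (normal_form_unique p_pr nsq Nw Nx).
Qed.
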